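(* Let $\beta\ge0$, $B>0$, $D\ge1$, $p\in(0,1/2)$, and consider graphs $G$ as in the context with maximum degree $D$ and $h=n^{-p}$. Let $a=a(\beta,B)$ and let $M_1(\psi)\ge M_2(\psi)$ be the largest and second largest entries of the vector $(|\psi_x|^2)_{x\in V}$. (i) Suppose $\beta B^2>\theta_c$ and $\max\{2p,4/5\}<q<1$. There is a constant $C$ depending only on $\beta,B,D,p,q$ such that if $n>C$, then with probability at least $1-e^{-n^q/C}$, $$\Big|\frac{H(\psi)}{n}+a^2\Big|\le Cn^{-(1-q)/4},\quad \Big|\frac{N(\psi)}{n}-B\Big|\le Cn^{-(1-q)/2},\quad \Big|\frac{M_1(\psi)}{n}-a\Big|\le Cn^{-(1-q)/4},\quad \frac{M_2(\psi)}{n}\le Cn^{-(1-q)}. \tag{7}$$ (ii) Suppose $\beta B^2<\theta_c$ and $\max\{(1+2p)/2,17/18\}<q<1$. There is a constant $C$ depending only on $\beta,B,D,p,q$ such that if $n>C$, then with probability at least $1-e^{-n^q/C}$, $$\Big|\frac{H(\psi)}{n}\Big|\le 2n^{-2(1-q)},\quad \Big|\frac{N(\psi)}{n}-B\Big|\le n^{-(1-q)},\quad \frac{M_1(\psi)}{n}\le n^{-(1-q)}. \tag{8}$$ (iii) Suppose $\beta B^2=\theta_c$ and $\max\{(1+2p)/2,17/18\}<q<1$. There is a constant $C$ depending only on $\beta,B,D,p,q$ such that if $n>C$, then with probability at least $1-e^{-n^q/C}$ either (7) or (8) holds.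
   Context: Let $G=(V,E)$ be a finite undirected graph without self-loops, $n=|V|$, $D$ its maximum degree, and $h>0$. For $f\in\mathbb{C}^V$ let $N(f)=\sum_{x\in V}|f_x|^2$ and $H(f)=\frac{2}{n}\sum_{(x,y)\in E}|(f_x-f_y)/h|^2-\frac1n\sum_{x\in V}|f_x|^4$ (first sum over edges, each counted once). With $df$ Lebesgue measure on $\mathbb{C}^V\cong\mathbb{R}^{2n}$, $\beta\ge0$, $B>0$, let $Z=\int e^{-\beta H(f)}\mathbf 1_{\{N(f)\le Bn\}}df$ and let $\psi$ be a random element of $\mathbb{C}^V$ with law $\tilde\mu(df)=Z^{-1}e^{-\beta H(f)}\mathbf 1_{\{N(f)\le Bn\}}df$. Let $m(\theta)=\frac{\theta}{2}-\frac12+\frac{\theta}{2}\sqrt{1-2/\theta}+\log(\frac12-\frac12\sqrt{1-2/\theta})$ for $\theta\ge2$; $m$ is strictly increasing with a unique zero $\theta_c\approx2.455407$. Define $a(\beta,B)=\frac B2+\frac B2\sqrt{1-\frac{2}{\beta B^2}}$ (for $\beta B^2\ge 2$). *)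

(* Defs.v *)
From HB Require Import structures.
From mathcomp Require Import all_boot all_order all_algebra.
From mathcomp Require Import all_classical all_reals all_analysis.
Set Implicit Arguments. Unset Strict Implicit. Unset Printing Implicit Defensive.
Import Order.TTheory GRing.Theory Num.Theory.
Local Open Scope ring_scope.

Section Defs.
Variable R : realType.

(* A complex number z is identified with the pair (Re z, Im z) : R * R,
   so C^V is identified with V -> R * R, i.e. with R^(2n). *)
Definition abs2 (z : R * R) : R := z.1 ^+ 2 + z.2 ^+ 2.
Definition csub (z w : R * R) : R * R := (z.1 - w.1, z.2 - w.2).

Variable V : finType.

Definition simple_graph (e : rel V) : Prop :=
  symmetric e /\ irreflexive e.

Definition degree (e : rel V) (x : V) : nat := #|[set y | e x y]|.
Definition max_degree (e : rel V) : nat := (\max_(x : V) degree e x)%N.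

Definition nV : R := (#|V|)%:R.

Definition Nf (f : V -> R * R) : R := \sum_(x : V) abs2 (f x).

(* sum over edges, each counted once: half the sum over ordered adjacent pairs *)
Definition edge_sum (e : rel V) (g : V -> V -> R) : R :=
  2^-1 * \sum_(x : V) \sum_(y : V | e x y) g x y.

Definition Hf (e : rel V) (h : R) (f : V -> R * R) : R :=
  2 / nV * edge_sum e (fun x y => abs2 (csub (f x) (f y)) / h ^+ 2)
  - nV^-1 * \sum_(x : V) abs2 (f x) ^+ 2.

Definition Mk (k : nat) (f : V -> R * R) : R :=
  nth 0 (sort (fun a b : R => b <= a) [seq abs2 (f x) | x <- enum V]) k.-1.

(* iterated Lebesgue integral over (R^2)^V (Tonelli: equals the Lebesgue
   integral on R^(2n) for nonnegative integrands) *)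
Fixpoint iint (s : seq V) (F : (V -> R * R) -> \bar R) (g : V -> R * R)
  : \bar R :=
  match s with
  | [::] => F g
  | x :: s' =>
      (\int[@lebesgue_measure R]_(a in setT)
        \int[@lebesgue_measure R]_(b in setT)
          iint s' F (fun z => if z == x then (a, b) else g z))%E
  end.

Definition integral_CV (F : (V -> R * R) -> \bar R) : \bar R :=
  iint (enum V) F (fun _ => (0, 0)).

Definition weight (e : rel V) (h beta B : R) (f : V -> R * R) : R :=
  expR (- (beta * Hf e h f)) * (if Nf f <= B * nV then 1 else 0).

Definition partition_Z (e : rel V) (h beta B : R) : \bar R :=
  integral_CV (fun f => (weight e h beta B f)%:E).

Definition prob_mu (e : rel V) (h beta B : R) (E : (V -> R * R) -> Prop) : R :=
  fine (integral_CV (fun f =>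
          (weight e h beta B f * (if `[< E f >] then 1 else 0))%:E))
  / fine (partition_Z e h beta B).

End Defs.

Definition m_fun (R : realType) (t : R) : R :=
  t / 2 - 2^-1 + t / 2 * Num.sqrt (1 - 2 / t)
  + ln (2^-1 - 2^-1 * Num.sqrt (1 - 2 / t)).

(* theta_c := the unique zero of m on [2, +oo) *)
Definition theta_c (R : realType) : R :=
  xget 0 [set t : R | 2 <= t /\ m_fun t = 0].

Definition a_fun (R : realType) (beta B : R) : R :=
  B / 2 + B / 2 * Num.sqrt (1 - 2 / (beta * B ^+ 2)).

Definition bounds7 (R : realType) (V : finType) (e : rel V) (h beta B C q : R)
  (f : V -> R * R) : Prop :=
  let n := @nV R V in
  let a := a_fun beta B in
  `|Hf e h f / n + a ^+ 2| <= C * powR n (- ((1 - q) / 4)) /\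
  `|Nf f / n - B| <= C * powR n (- ((1 - q) / 2)) /\
  `|Mk 1 f / n - a| <= C * powR n (- ((1 - q) / 4)) /\
  Mk 2 f / n <= C * powR n (- (1 - q)).

Definition bounds8 (R : realType) (V : finType) (e : rel V) (h : R) (B q : R)
  (f : V -> R * R) : Prop :=
  let n := @nV R V in
  `|Hf e h f / n| <= 2 * powR n (- (2 * (1 - q))) /\
  `|Nf f / n - B| <= powR n (- (1 - q)) /\
  Mk 1 f / n <= powR n (- (1 - q)).

(* Main.v *)
Require Import Defs.
From HB Require Import structures.
From mathcomp Require Import all_boot all_order all_algebra.
From mathcomp Require Import all_classical all_reals all_analysis measurable_realfun.
From mathcomp Require Import ring lra.
Set Implicit Arguments. Unset Strict Implicit. Unset Printing Implicit Defensive.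
Import Order.TTheory GRing.Theory Num.Theory.
Local Open Scope ring_scope.

(* Write [n] for the number of vertices, [X_x = |f_x|^2], [t = beta B^2].  The
   kinetic energy lies between [0] and [4 D B n^(2p)], which is negligible on the
   exponential scale [n^q], so only the weight [exp (beta/n * sum X^2)] on
   [sum X <= B n] matters.  A condensate carrying the fraction [y] of the maximal
   mass contributes [exp (n g(y))] relative to [(e pi B)^n], where
   [g(y) = t y^2 + ln (1 - y)]; the maximum of [g] near [y = a / B] is [m t], and
   [g(0) = 0], whence the transition at [m t = 0].

   Upper bound: call [x] a peak if [X_x > n^q], and let [Y] be the fraction of
   [B n] carried by the peaks.  There are at most [B n^(1-q)] peaks, so that
   replacing each by a factor [n^-3] costs only [e^(o(n^q))].  With [y] the value
   of [Y] rounded down to the grid [Z/n], tilting the other sites by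
   [exp (- X / (B (1 - y)))] dominates the weight by a product of sums of
   Gaussians, of total integral [(e pi B)^n e^(n g(y) + o(n^q))].  The dominating
   product has room to spare when there are several peaks, when mass is missing,
   or when the squares of the bulk sites sum to more than [n^(2q)]; so all
   deviations are exponentially unlikely, and only [y] near a maximum of [g]
   survives.

   Lower bound for [Z]: put one site in a unit box at the prescribed height and
   give the others Gaussian weights; an exponential Chebyshev bound controls
   their total mass up to [O (sqrt n)]. *)

(** * Iterated integrals over the plane *)

(** The integral of a nonnegative function is a supremum over simple functions below it, so
    monotonicity needs no measurability. Hence the event in [prob_mu] may be an arbitrary
    predicate. *)
Lemma le_integral_nomeas d (T : measurableType d) (R : realType)
    (mu : {measure set T -> \bar R}) (f g : T -> \bar R) :
  (forall x, (0 <= f x)%E) -> (forall x, (f x <= g x)%E) ->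
  (\int[mu]_(x in setT) f x <= \int[mu]_(x in setT) g x)%E.
Proof.
move=> f0 fg; rewrite !ge0_integralTE//; last by move=> x; exact: le_trans (fg x).
apply: ge_ereal_sup => _ [h hf <-]; apply: ereal_sup_ubound.
by exists h => // x; exact: le_trans (hf x) (fg x).
Qed.

Section iterated_integral.
Context {R : realType} {V : finType}.
Implicit Types (F G : (V -> R * R) -> \bar R) (g : V -> R * R) (s : seq V).

(* Measurability of [F] for the product sigma-algebra on [V -> R * R], phrased
   through arbitrary measurable parametrisations so that no measurable structure
   on the function space is needed. *)
Definition cmeas F := forall (d : measure_display) (T : measurableType d)
    (P : T -> V -> R * R),
  (forall x, measurable_fun setT (fun t => (P t x).1)) ->
  (forall x, measurable_fun setT (fun t => (P t x).2)) ->
  measurable_fun setT (fun t => F (P t)).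

Definition upd g (x : V) (ab : R * R) : V -> R * R :=
  fun z => if z == x then ab else g z.

Lemma iint_ge0 s F g : (forall f, (0 <= F f)%E) -> (0 <= iint s F g)%E.
Proof.
move=> F0; elim: s g => [|x s IH] g //=.
by apply: integral_ge0 => a _; apply: integral_ge0 => b _; exact: IH.
Qed.

Lemma le_iint s F G g : (forall f, (0 <= F f)%E) -> (forall f, (F f <= G f)%E) ->
  (iint s F g <= iint s G g)%E.
Proof.
move=> F0 FG; elim: s g => [|x s IH] g //=.
apply: le_integral_nomeas => a.
  by apply: integral_ge0 => b _; exact: iint_ge0.
by apply: le_integral_nomeas => b //; exact: iint_ge0.
Qed.

Lemma measurable_upd d (T : measurableType d) (P : T -> V -> R * R) (x : V)
    (a b : T -> R) :
  (forall x, measurable_fun setT (fun t => (P t x).1)) ->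
  (forall x, measurable_fun setT (fun t => (P t x).2)) ->
  measurable_fun setT a -> measurable_fun setT b ->
  (forall z, measurable_fun setT (fun t => (upd (P t) x (a t, b t) z).1)) /\
  (forall z, measurable_fun setT (fun t => (upd (P t) x (a t, b t) z).2)).
Proof.
by move=> P1 P2 ma mb; split=> z; rewrite /upd; case: eqP.
Qed.

Lemma cmeas_upd d (T : measurableType d) F (P : T -> V -> R * R) (x : V)
    (a b : T -> R) : cmeas F ->
  (forall x, measurable_fun setT (fun t => (P t x).1)) ->
  (forall x, measurable_fun setT (fun t => (P t x).2)) ->
  measurable_fun setT a -> measurable_fun setT b ->
  measurable_fun setT (fun t => F (upd (P t) x (a t, b t))).
Proof.
move=> mF P1 P2 ma mb; have [Q1 Q2] := measurable_upd x P1 P2 ma mb.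
exact: (mF _ _ (fun t => upd (P t) x (a t, b t))).
Qed.

(** Tonelli applied twice, over the parameter space enlarged by two real coordinates; this is why
    [cmeas] quantifies over every parameter space. *)
Lemma cmeas_iint s F : (forall f, (0 <= F f)%E) -> cmeas F -> cmeas (iint s F).
Proof.
move=> F0 mF; elim: s => [|x s IH] //= d T P mP1 mP2.
pose K (p : T * measurableTypeR R * measurableTypeR R) :=
  iint s F (upd (P p.1.1) x (p.1.2, p.2)).
have mK : measurable_fun setT K.
  have mfst2 : measurable_fun setT
      (fun p : T * measurableTypeR R * measurableTypeR R => p.1.1).
    exact: (measurableT_comp measurable_fst measurable_fst).
  have msnd : measurable_fun setT
      (fun p : T * measurableTypeR R * measurableTypeR R => p.1.2 : measurableTypeR R).
    exact: (measurableT_comp measurable_snd measurable_fst).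
  apply: (@cmeas_upd _ _ (iint s F) (fun p => P p.1.1) x (fun p => p.1.2)
    (fun p => p.2) IH _ _ msnd measurable_snd) => z.
    exact: (measurableT_comp (mP1 z) mfst2).
  exact: (measurableT_comp (mP2 z) mfst2).
have K0 p : (0 <= K p)%E by exact: iint_ge0.
have mK1 := @measurable_fun_fubini_tonelli_F _ _ _ _ R
  (@lebesgue_measure R) K mK K0.
pose K1 : T * measurableTypeR R -> \bar R := fubini_F (@lebesgue_measure R) K.
have K10 p : (0 <= K1 p)%E by apply: integral_ge0.
exact: (@measurable_fun_fubini_tonelli_F _ _ _ _ R
  (@lebesgue_measure R) K1 mK1 K10).
Qed.

Let mslice F g x a : cmeas F ->
  measurable_fun setT (fun b : measurableTypeR R => F (upd g x (a, b))).
Proof. by move=> mF; exact: (@cmeas_upd _ (measurableTypeR R) F (fun=> g) x (fun=> a) id). Qed.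

Let mslice2 F g x : cmeas F -> (forall f, (0 <= F f)%E) ->
  measurable_fun setT (fun a : measurableTypeR R =>
    (\int[@lebesgue_measure R]_(b in setT) F (upd g x (a, b)))%E).
Proof.
move=> mF F0.
apply: (@measurable_fun_fubini_tonelli_F _ _ _ _ R (@lebesgue_measure R)
  (fun p : measurableTypeR R * measurableTypeR R => F (upd g x (p.1, p.2)))) => //.
exact: (@cmeas_upd _ _ F (fun=> g) x fst snd).
Qed.

Lemma iintD s F G g : (forall f, (0 <= F f)%E) -> (forall f, (0 <= G f)%E) ->
  cmeas F -> cmeas G ->
  iint s (fun f => (F f + G f)%E) g = (iint s F g + iint s G g)%E.
Proof.
move=> F0 G0 mF mG; elim: s g => [|x s IH] g //=.
have mIF := @cmeas_iint s _ F0 mF; have mIG := @cmeas_iint s _ G0 mG.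
have IF0 f : (0 <= iint s F f)%E by exact: iint_ge0.
have IG0 f : (0 <= iint s G f)%E by exact: iint_ge0.
under eq_integral => a _.
  under eq_integral => b _ do rewrite IH.
  rewrite ge0_integralD//; [|exact: mslice mIF|exact: mslice mIG].
  over.
rewrite ge0_integralD//; [|exact: mslice2 mIF _|by move=> *; exact: integral_ge0|exact: mslice2 mIG _].
by move=> *; exact: integral_ge0.
Qed.

Definition plane_integral (phi : R * R -> R) : \bar R :=
  (\int[@lebesgue_measure R]_(a in setT)
     \int[@lebesgue_measure R]_(b in setT) (phi (a, b))%:E)%E.

(** Sites outside [s] hold the values of the background [g]; with their factors kept in the formula,
    the induction integrates out one plane at a time. *)
Lemma iint_prod s (phi : V -> R * R -> R) (c : V -> R) g (k : R) :
  uniq s -> 0 <= k ->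
  (forall x z, 0 <= phi x z) -> (forall x, measurable_fun setT (phi x)) ->
  (forall x, plane_integral (phi x) = (c x)%:E) ->
  iint s (fun f => (k * \prod_x phi x (f x))%:E) g =
  (k * (\prod_(x <- s) c x) * \prod_(x | x \notin s) phi x (g x))%:E.
Proof.
move=> us k0 phi0 mphi cE.
have c0 x : 0 <= c x.
  rewrite -lee_fin -cE; apply: integral_ge0 => a _; apply: integral_ge0 => b _.
  by rewrite lee_fin.
elim: s us g => [|x s IH] /= us g.
  by rewrite big_nil mulr1; congr (_ * _)%:E; apply: eq_bigl => x.
have /andP[xs us'] := us.
pose D := k * (\prod_(y <- s) c y) * \prod_(y | y \notin x :: s) phi y (g y).
have D0 : 0 <= D.
  by rewrite !mulr_ge0//; apply: prodr_ge0.
have E a b : iint s (fun f => (k * \prod_y phi y (f y))%:E) (upd g x (a, b))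
    = (D%:E * (phi x (a, b))%:E)%E.
  rewrite IH// -EFinM /D; congr (_%:E); rewrite -[RHS]mulrA; congr (_ * _).
  rewrite (bigD1 x)//= {1}/upd eqxx [RHS]mulrC; congr (_ * _).
  apply: eq_big => [y|y /andP[_ yx]]; last by rewrite /upd (negbTE yx).
  by rewrite inE negb_or andbC.
under eq_integral => a _.
  under eq_integral => b _ do rewrite -/(upd g x (a, b)) E.
  rewrite ge0_integralZl_EFin//; first over.
  - by move=> b _; rewrite lee_fin.
  - apply/measurable_EFinP; apply: (measurableT_comp (mphi x)).
    exact: (@measurable_pair1 _ _ (measurableTypeR R) (measurableTypeR R)).
rewrite ge0_integralZl_EFin//.
- rewrite -[X in (_ * X)%E]/(plane_integral (phi x)) cE -EFinM /D big_cons.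
  by congr (_%:E); ring.
- by move=> a _; apply: integral_ge0 => b _; rewrite lee_fin.
- apply: (@measurable_fun_fubini_tonelli_F _ _ _ _ R (@lebesgue_measure R)
    (fun p : measurableTypeR R * measurableTypeR R => (phi x p)%:E)) => //.
    by apply/measurable_EFinP; exact: mphi.
  by move=> p; rewrite lee_fin.
Qed.

Lemma integral_CV_prod (phi : V -> R * R -> R) (c : V -> R) (k : R) :
  0 <= k ->
  (forall x z, 0 <= phi x z) -> (forall x, measurable_fun setT (phi x)) ->
  (forall x, plane_integral (phi x) = (c x)%:E) ->
  integral_CV (fun f => (k * \prod_x phi x (f x))%:E) = (k * \prod_x c x)%:E.
Proof.
move=> k0 phi0 mphi cE; rewrite /integral_CV (@iint_prod _ phi c _ k) ?enum_uniq//.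
rewrite [X in _ * X]big_pred0 ?mulr1 ?big_enum//.
by move=> x; rewrite mem_enum.
Qed.

End iterated_integral.

(** * Integrals of Gaussians and boxes over the plane *)

Section plane_integrals.
Context {R : realType}.
Implicit Types (phi psi : R * R -> R) (l k : R).

Let mslice phi (a : R) : measurable_fun setT phi ->
  measurable_fun setT (fun b : measurableTypeR R => (phi (a, b))%:E).
Proof.
move=> mphi; apply/measurable_EFinP; apply: (measurableT_comp mphi).
exact: (@measurable_pair1 _ _ (measurableTypeR R) (measurableTypeR R)).
Qed.

Let mslice2 phi : measurable_fun setT phi -> (forall z, 0 <= phi z) ->
  measurable_fun setT (fun a : measurableTypeR R =>
    (\int[@lebesgue_measure R]_(b in setT) (phi (a, b))%:E)%E).
Proof.
move=> mphi phi0.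
apply: (@measurable_fun_fubini_tonelli_F _ _ _ _ R (@lebesgue_measure R)
    (fun p : measurableTypeR R * measurableTypeR R => (phi p)%:E)) => //.
exact/measurable_EFinP.
Qed.

Lemma plane_integralD phi psi (a b : R) :
  measurable_fun setT phi -> measurable_fun setT psi ->
  (forall z, 0 <= phi z) -> (forall z, 0 <= psi z) ->
  plane_integral phi = a%:E -> plane_integral psi = b%:E ->
  plane_integral (fun z => phi z + psi z) = (a + b)%:E.
Proof.
move=> mphi mpsi phi0 psi0 ia ib; rewrite EFinD -ia -ib /plane_integral.
under eq_integral => x _.
  under eq_integral => y _ do rewrite EFinD.
  rewrite ge0_integralD//; first over.
  - by move=> *; rewrite lee_fin.
  - exact: mslice.
  - by move=> *; rewrite lee_fin.
  - exact: mslice.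
rewrite ge0_integralD//.
- by move=> *; apply: integral_ge0 => *; rewrite lee_fin.
- exact: mslice2.
- by move=> *; apply: integral_ge0 => *; rewrite lee_fin.
- exact: mslice2.
Qed.

Lemma plane_integralZ phi k (a : R) :
  measurable_fun setT phi -> (forall z, 0 <= phi z) -> 0 <= k ->
  plane_integral phi = a%:E ->
  plane_integral (fun z => k * phi z) = (k * a)%:E.
Proof.
move=> mphi phi0 k0 ia; rewrite EFinM -ia /plane_integral.
under eq_integral => x _.
  under eq_integral => y _ do rewrite EFinM.
  rewrite ge0_integralZl_EFin//; first over.
  - by move=> *; rewrite lee_fin.
  - exact: mslice.
rewrite ge0_integralZl_EFin//.
- by move=> *; apply: integral_ge0 => *; rewrite lee_fin.
- exact: mslice2.
Qed.

Lemma integral_gauss l : 0 < l ->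
  (\int[@lebesgue_measure R]_(x in setT) (expR (- (l * x ^+ 2)))%:E
   = (Num.sqrt (pi / l))%:E)%E.
Proof.
(* The standard deviation for which the normal density is proportional to the given Gaussian. *)
move=> l0; pose s : R := Num.sqrt ((2 * l)^-1).
have s2 : s ^+ 2 = (2 * l)^-1 by rewrite sqr_sqrtr// invr_ge0 mulr_ge0// ltW.
have s0 : s != 0 by rewrite gt_eqF// sqrtr_gt0 invr_gt0 mulr_gt0.
have pk0 := normal_peak_gt0 s0.
have E x : expR (- (l * x ^+ 2)) = (normal_peak s)^-1 * normal_pdf 0 s x.
  rewrite normal_pdfE//= mulrA mulVf ?gt_eqF// mul1r /normal_fun subr0 s2.
  by congr expR; field; rewrite gt_eqF.
under eq_integral => x _ do rewrite E EFinM.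
rewrite ge0_integralZl_EFin//.
- rewrite integral_normal_pdf mule1; congr (_%:E).
  by rewrite /normal_peak invrK s2; congr Num.sqrt; field; rewrite gt_eqF.
- by move=> x _; rewrite lee_fin normal_pdf_ge0.
- by apply/measurable_EFinP; exact: measurable_normal_pdf.
- by rewrite invr_ge0 ltW.
Qed.

Definition gauss l (z : R * R) := expR (- (l * abs2 z)).

Lemma gauss_ge0 l (z : R * R) : 0 <= gauss l z. Proof. exact: expR_ge0. Qed.

Lemma measurable_abs2 : measurable_fun setT (@abs2 R).
Proof.
by apply: measurable_funD; apply: measurable_funX;
  [exact: measurable_fst|exact: measurable_snd].
Qed.

Lemma measurable_gauss l : measurable_fun setT (gauss l).
Proof.
apply: measurableT_comp => //; apply: measurableT_comp => //.
by apply: measurable_funM => //; exact: measurable_abs2.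
Qed.

Lemma plane_integral_gauss l : 0 < l -> plane_integral (gauss l) = (pi / l)%:E.
Proof.
move=> l0; rewrite /plane_integral.
have mg : measurable_fun setT (fun x : measurableTypeR R => (expR (- (l * x ^+ 2)))%:E).
  apply/measurable_EFinP; apply: measurableT_comp => //; apply: measurableT_comp => //.
  by apply: measurable_funM => //; exact: measurable_funX.
under eq_integral => x _.
  under eq_integral => y _ do rewrite /gauss /abs2/= mulrDr opprD expRD EFinM.
  rewrite ge0_integralZl_EFin ?expR_ge0//.
  rewrite integral_gauss// muleC.
  over.
rewrite ge0_integralZl_EFin ?sqrtr_ge0//.
by rewrite integral_gauss// -EFinM -expr2 sqr_sqrtr// divr_ge0 ?pi_ge0// ltW.
Qed.

(** A unit square whose points have squared modulus close to [r ^+ 2]; in the lower bound for [Z] it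
    holds the condensate at the cost of a factor [1]. *)
Definition box (r : R) (z : R * R) : R := \1_`[r, r + 1] z.1 * \1_`[0, 1] z.2.

Lemma box_ge0 r z : 0 <= box r z.
Proof. by rewrite /box !indicE mulr_ge0. Qed.

Lemma measurable_box r : measurable_fun setT (box r).
Proof.
by apply: measurable_funM; apply: measurableT_comp => //; exact: measurable_indic.
Qed.

Lemma plane_integral_box r : plane_integral (box r) = 1%:E.
Proof.
rewrite /plane_integral.
have I01 (x : R) : (\int[@lebesgue_measure R]_(y in setT) (\1_`[x, x + 1] y)%:E = 1)%E.
  have mI : measurable (`[x, x + 1]%classic : set (measurableTypeR R)).
    exact: measurable_itv.
  rewrite (integral_indic (@lebesgue_measure R) measurableT mI) setIT.
  transitivity (lebesgue_measure (`[x, x + 1]%classic : set R)) => //.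
  by rewrite lebesgue_measure_itv/= lte_fin ltrDl ltr01 -EFinB addrAC subrr add0r.
under eq_integral => x _.
  under eq_integral => y _ do rewrite /box/= EFinM.
  rewrite ge0_integralZl_EFin//.
    rewrite -[X in `[0, X]]add0r I01 mule1.
    over.
  by apply/measurable_EFinP; exact: measurable_indic.
exact: I01.
Qed.

Lemma box_abs2 r z : 0 <= r -> box r z != 0 ->
  r ^+ 2 <= abs2 z <= r ^+ 2 + 2 * r + 2.
Proof.
move=> r0; rewrite /box !indicE mulf_eq0 negb_or !pnatr_eq0 !eqb0 !negbK.
rewrite !mem_setE !in_itv/= /abs2 => /andP[/andP[a b] /andP[c d]]; apply/andP; split; nra.
Qed.
End plane_integrals.

(** * Comparing weights and probabilities *)

Section comparison.
Context {R : realType} {V : finType}.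
Implicit Types (F G : (V -> R * R) -> R).

Definition rmeas F := cmeas (fun f => (F f)%:E).

Lemma rmeasE F : rmeas F <-> forall (d : measure_display) (T : measurableType d)
    (P : T -> V -> R * R),
  (forall x, measurable_fun setT (fun t => (P t x).1)) ->
  (forall x, measurable_fun setT (fun t => (P t x).2)) ->
  measurable_fun setT (fun t => F (P t)).
Proof.
by split=> mF d T P P1 P2; [apply/measurable_EFinP|apply/measurable_EFinP]; exact: mF.
Qed.

Lemma rmeas_cst k : rmeas (fun=> k).
Proof. by apply/rmeasE. Qed.

Lemma rmeasD F G : rmeas F -> rmeas G -> rmeas (fun f => F f + G f).
Proof.
move=> /rmeasE mF /rmeasE mG; apply/rmeasE => d T P P1 P2.
by apply: measurable_funD; [exact: mF|exact: mG].
Qed.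

Lemma rmeasM F G : rmeas F -> rmeas G -> rmeas (fun f => F f * G f).
Proof.
move=> /rmeasE mF /rmeasE mG; apply/rmeasE => d T P P1 P2.
by apply: measurable_funM; [exact: mF|exact: mG].
Qed.

Lemma rmeas_sum I (s : seq I) (P : pred I) (F : I -> (V -> R * R) -> R) :
  (forall i, rmeas (F i)) -> rmeas (fun f => \sum_(i <- s | P i) F i f).
Proof.
move=> mF; apply/rmeasE => d T Q P1 P2.
under eq_fun do rewrite big_mkcond.
apply: measurable_sum => i; case: (P i) => //.
by have /rmeasE := mF i; exact.
Qed.

Lemma rmeas_prod I (s : seq I) (F : I -> (V -> R * R) -> R) :
  (forall i, rmeas (F i)) -> rmeas (fun f => \prod_(i <- s) F i f).
Proof.
move=> mF; elim: s => [|i s IH].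
  under [X in rmeas X]eq_fun do rewrite big_nil.
  exact: rmeas_cst.
under [X in rmeas X]eq_fun do rewrite big_cons.
exact: (@rmeasM (F i) (fun f => \prod_(j <- s) F j f) (mF i) IH).
Qed.

Lemma rmeas_coord x (phi : R * R -> R) : measurable_fun setT phi ->
  rmeas (fun f : V -> R * R => phi (f x)).
Proof.
move=> mphi; apply/rmeasE => d T P P1 P2.
rewrite (_ : (fun t => _) = phi \o (fun t => ((P t x).1, (P t x).2))); last first.
  by apply/funext => t /=; case: (P t x).
exact: (measurableT_comp mphi (measurable_fun_pair (P1 x) (P2 x))).
Qed.

Lemma rmeas_comp F (phi : R -> R) : measurable_fun setT phi -> rmeas F ->
  rmeas (fun f => phi (F f)).
Proof.
move=> mphi /rmeasE mF; apply/rmeasE => d T P P1 P2.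
exact: (measurableT_comp mphi (mF _ _ _ P1 P2)).
Qed.

Lemma rmeas_le F (k a b : R) : rmeas F -> rmeas (fun f => if F f <= k then a else b).
Proof.
move=> /rmeasE mF; apply/rmeasE => d T P P1 P2.
apply: measurable_fun_ifT => //; apply: measurable_fun_ler => //.
exact: mF.
Qed.

Lemma rmeas_weight (e : rel V) (h beta B : R) : rmeas (weight e h beta B).
Proof.
have mabs x : rmeas (fun f : V -> R * R => abs2 (f x)).
  by apply: rmeas_coord; exact: measurable_abs2.
have mN F : rmeas F -> rmeas (fun f => - F f).
  by apply: (@rmeas_comp _ (fun x => - x)); apply: (@measurable_funN _ _ _ _ id).
have mX F : rmeas F -> rmeas (fun f => F f ^+ 2).
  by apply: (@rmeas_comp _ (fun x => x ^+ 2)); exact: measurable_funX.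
have mdiff x y : rmeas (fun f : V -> R * R => abs2 (csub (f x) (f y))).
  have m1 z : rmeas (fun f : V -> R * R => (f z).1).
    exact: (@rmeas_coord z fst measurable_fst).
  have m2 z : rmeas (fun f : V -> R * R => (f z).2).
    exact: (@rmeas_coord z snd measurable_snd).
  by apply: rmeasD; apply: mX; apply: rmeasD => //; exact: mN.
have mE : rmeas (fun f : V -> R * R =>
    edge_sum e (fun x y => abs2 (csub (f x) (f y)) / h ^+ 2)).
  apply: (@rmeasM (fun=> _)); first exact: rmeas_cst.
  apply: rmeas_sum => x; apply: rmeas_sum => y.
  by apply: rmeasM => //; exact: rmeas_cst.
have mS : rmeas (fun f : V -> R * R => \sum_x abs2 (f x) ^+ 2).
  by apply: rmeas_sum => x; exact: mX.
have mH : rmeas (Hf e h : (V -> R * R) -> R).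
  apply: (@rmeasD (fun f => _ * _) (fun f => - (_ * _))).
    by apply: rmeasM => //; exact: rmeas_cst.
  by apply: mN; apply: rmeasM => //; exact: rmeas_cst.
have mNf : rmeas (@Nf R V) by exact: rmeas_sum.
apply: (@rmeasM (fun f => expR (- (beta * Hf e h f)))
  (fun f => if Nf f <= B * nV R V then 1 else 0)); last exact: rmeas_le.
apply: (@rmeas_comp _ expR) => //; apply: mN.
by apply: rmeasM => //; exact: rmeas_cst.
Qed.

Lemma integral_CV_ge0 F : (forall f, 0 <= F f) ->
  (0 <= integral_CV (fun f => (F f)%:E))%E.
Proof. by move=> F0; apply: iint_ge0 => f; rewrite lee_fin. Qed.

Lemma le_integral_CV F G : (forall f, 0 <= F f) -> (forall f, F f <= G f) ->
  (integral_CV (fun f => (F f)%:E) <= integral_CV (fun f => (G f)%:E))%E.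
Proof. by move=> F0 FG; apply: le_iint => f; rewrite lee_fin. Qed.

Lemma integral_CVD F G : (forall f, 0 <= F f) -> (forall f, 0 <= G f) ->
  rmeas F -> rmeas G ->
  (integral_CV (fun f => (F f + G f)%:E) =
   integral_CV (fun f => (F f)%:E) + integral_CV (fun f => (G f)%:E))%E.
Proof.
by move=> F0 G0 mF mG; rewrite -[RHS]iintD// => f; rewrite lee_fin.
Qed.

Lemma integral_CV0 : integral_CV (fun _ : V -> R * R => 0%:E) = 0%:E.
Proof.
have H s g : iint s (fun _ : V -> R * R => 0%:E) g = 0%:E.
  elim: s g => //= x s IH g.
  by rewrite integral0_eq// => a _; rewrite integral0_eq.
exact: H.
Qed.

Lemma integral_CV_sum I (s : seq I) (F : I -> (V -> R * R) -> R) (c : I -> R) :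
  (forall i f, 0 <= F i f) -> (forall i, rmeas (F i)) ->
  (forall i, integral_CV (fun f => (F i f)%:E) = (c i)%:E) ->
  integral_CV (fun f => (\sum_(i <- s) F i f)%:E) = (\sum_(i <- s) c i)%:E.
Proof.
move=> F0 mF cE; elim: s => [|i s IH].
  under [X in integral_CV X]eq_fun do rewrite big_nil.
  by rewrite big_nil integral_CV0.
under [X in integral_CV X]eq_fun do rewrite big_cons.
rewrite integral_CVD ?IH ?cE ?big_cons//.
  by move=> f; apply: sumr_ge0.
exact: rmeas_sum.
Qed.

Lemma rmeas_plane_prod (phi : V -> R * R -> R) :
  (forall x, measurable_fun setT (phi x)) ->
  rmeas (fun f => \prod_x phi x (f x)).
Proof. by move=> mphi; apply: rmeas_prod => x; exact: rmeas_coord. Qed.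

Lemma integral_CV_scale_prod (phi : V -> R * R -> R) (c : V -> R) (k : R) :
  0 <= k -> (forall x z, 0 <= phi x z) ->
  (forall x, measurable_fun setT (phi x)) ->
  (forall x, plane_integral (phi x) = (c x)%:E) ->
  [/\ forall f, 0 <= k * \prod_x phi x (f x),
      rmeas (fun f => k * \prod_x phi x (f x)) &
      integral_CV (fun f => (k * \prod_x phi x (f x))%:E) =
      (k * \prod_x c x)%:E].
Proof.
move=> k0 phi0 mphi cE; split.
- by move=> f; rewrite mulr_ge0// prodr_ge0.
- by apply: rmeasM; [exact: rmeas_cst|exact: rmeas_plane_prod].
- exact: integral_CV_prod.
Qed.

Lemma weight_ge0 (e : rel V) h beta B f : 0 <= weight e h beta B f :> R.
Proof. by rewrite /weight mulr_ge0 ?expR_ge0//; case: ifP. Qed.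

(* Only the dominating function [U] needs to be measurable: the event is
   estimated from inside by [max 0 (weight - U)]. *)
Lemma prob_mu_ge (e : rel V) (h beta B : R) (E : (V -> R * R) -> Prop)
    (U : (V -> R * R) -> R) (z u : R) :
  (forall f, 0 <= U f) -> rmeas U ->
  integral_CV (fun f => (U f)%:E) = u%:E ->
  (forall f, ~ E f -> weight e h beta B f <= U f) ->
  (partition_Z e h beta B < +oo)%E ->
  0 < z -> (z%:E <= partition_Z e h beta B)%E ->
  1 - u / z <= prob_mu e h beta B E.
Proof.
move=> U0 mU iU wU Zfin z0 zZ.
set w := weight e h beta B; pose G f := Num.max 0 (w f - U f).
have w0 f : 0 <= w f by exact: weight_ge0.
have G0 f : 0 <= G f by rewrite /G le_max lexx.
have mw : rmeas w by exact: rmeas_weight.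
have mG : rmeas G.
  have /rmeasE mw' := mw; have /rmeasE mU' := mU.
  apply/rmeasE => d T P P1 P2; apply: measurable_maxr => //.
  by apply: measurable_funB; [exact: mw'|exact: mU'].
have u0 : 0 <= u by rewrite -lee_fin -iU integral_CV_ge0.
set I := integral_CV (fun f => (w f * (if `[< E f >] then 1 else 0))%:E).
have GI : (integral_CV (fun f => (G f)%:E) <= I)%E.
  apply: le_integral_CV => // f; rewrite /G ge_max.
  case: asboolP => Ef; first by rewrite mulr1 w0 gerBl U0.
  by rewrite mulr0 lexx/= subr_le0 wU.
have IZ : (I <= partition_Z e h beta B)%E.
  apply: le_integral_CV => f; first by rewrite mulr_ge0//; case: ifP.
  by case: ifP => _; rewrite ?mulr1// mulr0.
(* Integrating [w <= G + U]; together with [GI] this leaves at most [u] for the complement of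
   [E]. *)
have ZGU : (partition_Z e h beta B <= integral_CV (fun f => (G f)%:E) + u%:E)%E.
  rewrite -iU -integral_CVD//; apply: le_integral_CV => // f.
  by rewrite -lerBlDr /G le_max lexx orbT.
have I0 : (0 <= I)%E by apply: integral_CV_ge0 => f; rewrite mulr_ge0//; case: ifP.
rewrite /prob_mu -/I; move: Zfin zZ ZGU IZ.
case: (partition_Z e h beta B) => [Z _| |]//.
rewrite lee_fin => zZ ZGU.
case: I I0 GI => [i| |]// i0 GI; rewrite ?lee_fin//= => iZ.
have Z0 : 0 < Z by exact: lt_le_trans zZ.
have : Z <= i + u.
  by rewrite -lee_fin (le_trans ZGU)// EFinD leeD2r.
move=> Ziu; rewrite ler_pdivlMr// mulrBl mul1r lerBlDr (le_trans Ziu)// lerD2l.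
by rewrite mulrAC ler_pdivlMr// ler_wpM2l.
Qed.

(** [Q] takes over where the profile [P] is not below the weight, so that only full product
    integrals have to be computed. *)
Lemma partition_Z_ge (e : rel V) (h beta B : R) (P Q : (V -> R * R) -> R)
    (a b : R) :
  (forall f, 0 <= P f) -> rmeas P -> integral_CV (fun f => (P f)%:E) = a%:E ->
  (forall f, 0 <= Q f) -> rmeas Q -> integral_CV (fun f => (Q f)%:E) = b%:E ->
  (forall f, P f <= weight e h beta B f + Q f) ->
  ((a - b)%:E <= partition_Z e h beta B)%E.
Proof.
move=> P0 mP aE Q0 mQ bE PwQ; rewrite EFinB leeBlDr//.
rewrite -aE -bE -integral_CVD//; [exact: le_integral_CV| |exact: rmeas_weight].
by move=> f; exact: weight_ge0.
Qed.

End comparison.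

(** * The rate function *)

Section free_energy.
Context {R : realType}.
Implicit Types (x y t u k w v : R).

(** * Inequalities for the logarithm *)

Lemma ge_start_derive_ge0 (f f' : R -> R) (a : R) :
  (forall x, a <= x -> is_derive x 1 f (f' x)) ->
  (forall x, a <= x -> 0 <= f' x) -> forall x, a <= x -> f a <= f x.
Proof.
move=> df f'0 x ax; apply: (@ger0_derive1_ndecr _ f a x) => // [y|y|].
- by rewrite in_itv/= => /andP[/ltW ay _]; have [] := df _ ay.
- rewrite in_itv/= => /andP[/ltW ay _]; rewrite derive1E.
  by have [_ ->] := df _ ay; exact: f'0.
- apply: derivable_within_continuous => y; rewrite in_itv/= => /andP[ay _].
  by have [] := df _ ay.
Qed.

(** The difference vanishes at [1] and has derivative [(1 - y^-1) ^+ 2 / 2]. *)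
Lemma ln_le_sinh x : 1 <= x -> ln x <= (x - x^-1) / 2.
Proof.
move=> x1; rewrite -subr_ge0.
pose f (y : R) := (y - y^-1) / 2 - ln y.
suff: f 1 <= f x by rewrite {1}/f ln1 invr1 subrr mul0r subrr.
apply: (ge_start_derive_ge0 (f := f) (f' := fun y => (1 - y^-1) ^+ 2 / 2)) => // y y1.
  have y0 : 0 < y by lra.
  have yn0 : y != 0 by rewrite gt_eqF.
  have := is_derive1_ln y0 => dln.
  have dV : is_derive y 1 (fun z => z^-1) (- y ^- 2).
    apply: DeriveDef; first exact: derivableV.
    by rewrite deriveV// derive_id scaler1.
  apply: is_derive_eq.
  rewrite !scaler0 ?addr0 /GRing.scale/=.
  by field.
by rewrite divr_ge0// sqr_ge0.
Qed.

(** The [1/1] Padé approximant of the logarithm at [1]: the difference has derivative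
    [(y - 1) ^+ 2 / (y * (y + 1) ^+ 2)]. *)
Lemma ln_ge_pade x : 1 <= x -> 2 * (x - 1) / (x + 1) <= ln x.
Proof.
move=> x1.
pose f (y : R) := ln y + 4 * (y + 1)^-1.
have fx : f 1 <= f x.
  apply: (ge_start_derive_ge0 (f := f)
    (f' := fun y => (y - 1) ^+ 2 / (y * (y + 1) ^+ 2))) => // y y1.
    have y0 : 0 < y by lra.
    have yn0 : y != 0 by rewrite gt_eqF.
    have y1n0 : y + 1 != 0 by rewrite gt_eqF//; lra.
    have := is_derive1_ln y0 => dln.
    have dV : is_derive y 1 (fun z => (z + 1)^-1) (- (y + 1) ^- 2).
      apply: DeriveDef; first exact: derivableV.
      by rewrite deriveV// deriveD// derive_id derive_cst addr0 scaler1.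
    apply: is_derive_eq.
    rewrite /GRing.scale/= ?mulr0 ?addr0 ?add0r.
    by field; rewrite yn0 y1n0.
  by rewrite divr_ge0// ?mulr_ge0 ?sqr_ge0//; lra.
move: fx; rewrite /f ln1 add0r (_ : 4 * (1 + 1)^-1 = 2 :> R); last by field.
move=> fx.
have -> : 2 * (x - 1) / (x + 1) = 2 - 4 * (x + 1)^-1.
  by field; rewrite gt_eqF//; lra.
lra.
Qed.

Lemma ln1B_le v : 0 <= v < 1 -> ln (1 - v) <= - v - v ^+ 2 / 2.
Proof.
move=> /andP[v0 v1]; have v1' : 0 < 1 - v by lra.
have x1 : 1 <= (1 - v)^-1 by rewrite invf_ge1//; lra.
have := ln_ge_pade x1; rewrite lnV ?posrE//.
have -> : 2 * ((1 - v)^-1 - 1) / ((1 - v)^-1 + 1) = v + v ^+ 2 / (2 - v).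
  by field; rewrite !gt_eqF//; lra.
have : v ^+ 2 / 2 <= v ^+ 2 / (2 - v).
  by rewrite ler_wpM2l ?sqr_ge0// lef_pV2 ?posrE; lra.
lra.
Qed.

Lemma le_ln_sub1 x : 0 < x -> ln x <= x - 1.
Proof. move=> x0; have := @le_ln1Dx R (x - 1); rewrite (_ : 1 + (x - 1) = x); last lra. by apply; lra. Qed.

(* [k w^2 - w + ln (1 + w)] decreases from [0] and then increases. *)
Lemma phi_le0 k w : 0 <= w -> 0 < k -> 2 * k * (1 + w) <= 1 ->
  k * w ^+ 2 - w + ln (1 + w) <= 0.
Proof.
move=> w0 k0 kw; have w1 : 1 <= 1 + w by lra.
have := ln_le_sinh w1.
have -> : (1 + w - (1 + w)^-1) / 2 = w - w ^+ 2 * (2 * (1 + w))^-1.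
  by field; rewrite gt_eqF//; lra.
have : w ^+ 2 * k <= w ^+ 2 * (2 * (1 + w))^-1.
  rewrite ler_wpM2l ?sqr_ge0//.
  by rewrite -[leRHS]mul1r ler_pdivlMr; lra.
lra.
Qed.

(** Left of the turning point [2 k (1 + w) = 1] the function is below its value at the origin. Right
    of it the function increases up to [w1]; the increment is bounded by [ln_ge_pade] at the ratio
    [(1 + w1) / (1 + w)]. *)
Lemma phi_le_max k w w1 : 0 <= w <= w1 -> 0 < k ->
  k * w1 ^+ 2 - w1 + ln (1 + w1) <= 0 -> k * w ^+ 2 - w + ln (1 + w) <= 0.
Proof.
move=> /andP[w0 ww1] k0 h1.
have [kw|kw] := lerP (2 * k * (1 + w)) 1; first exact: phi_le0.
have x1 : 1 <= (1 + w1) / (1 + w) by rewrite ler_pdivlMr ?mul1r; lra.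
have := ln_ge_pade x1; rewrite ln_div ?posrE; try lra.
have -> : 2 * ((1 + w1) / (1 + w) - 1) / ((1 + w1) / (1 + w) + 1) =
    (w1 - w) * (2 / (2 + w1 + w)).
  by field; rewrite !gt_eqF//; lra.
have s0 : 0 < 2 + w1 + w by lra.
have : (1 - k * (w1 + w)) <= 2 / (2 + w1 + w).
  have kd : 0 <= k * (w1 - w) by rewrite mulr_ge0//; lra.
  have : 0 <= (w1 + w) * (k * (2 + w1 + w) - 1) by rewrite mulr_ge0//; lra.
  rewrite ler_pdivlMr//; lra.
move=> /(ler_wpM2l (x := w1 - w)) h; have {}h := h ltac:(lra); nra.
Qed.

(** The larger root of [2 t u (1 - u) = 1], the critical point equation of the rate function;
    [a_fun beta B] is [B] times this fraction. *)
Definition cond_frac t := (1 + Num.sqrt (1 - 2 / t)) / 2.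

(* [gfun t y] is the exponential rate of a condensate carrying the fraction [y]
   of the mass, at [t = beta * B ^+ 2]. *)
Definition gfun t y := t * y ^+ 2 + ln (1 - y).

Section at_t.
Variable t : R.
Hypothesis t2 : 2 <= t.
Let u := cond_frac t.

Lemma cond_frac_itv : 2^-1 <= u < 1.
Proof.
have t0 : 0 < t by move: t2; lra.
have s0 : 0 <= Num.sqrt (1 - 2 / t) by exact: sqrtr_ge0.
have s1 : Num.sqrt (1 - 2 / t) < 1.
  rewrite -[ltRHS]sqrtr1 ltr_sqrt// gtrBl divr_gt0//.
move: s0 s1; rewrite /u /cond_frac; set s := Num.sqrt _ => s0 s1.
by apply/andP; split; lra.
Qed.

Lemma cond_frac_eq : 2 * t * u * (1 - u) = 1.
Proof.
have t0 : 0 < t by move: t2; lra.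
have h : 0 <= 1 - 2 / t by rewrite subr_ge0 ler_pdivrMr ?mul1r.
have := sqr_sqrtr h; rewrite /u /cond_frac; set s := Num.sqrt _ => s2.
have -> : 2 * t * ((1 + s) / 2) * (1 - (1 + s) / 2) = t * (1 - s ^+ 2) / 2 by field.
by rewrite s2; field; rewrite gt_eqF.
Qed.

Lemma m_fun_gfun : m_fun t = gfun t u.
Proof.
have t0 : 0 < t by move: t2; lra.
have h : 0 <= 1 - 2 / t by rewrite subr_ge0 ler_pdivrMr ?mul1r.
have := sqr_sqrtr h; rewrite /m_fun /gfun /u /cond_frac; set s := Num.sqrt _ => s2.
have -> : t * ((1 + s) / 2) ^+ 2 = t * (1 + 2 * s + s ^+ 2) / 4 by field.
rewrite s2; have -> : 1 - (1 + s) / 2 = 2^-1 - 2^-1 * s by field.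
by field; rewrite gt_eqF.
Qed.

(** Equality would force [t = 2], where the rate [2^-1 + ln 2^-1] is negative. Strictness makes the
    maximum at [u] nondegenerate ([k < 2^-1] below). *)
Lemma cond_frac_gt_half : 0 <= m_fun t -> 2^-1 < u.
Proof.
have /andP[u1 u2] := cond_frac_itv.
rewrite lt_neqAle u1 andbT => m0; apply/eqP => uE.
have := cond_frac_eq; rewrite -uE => e.
have tE : t = 2 by lra.
move: m0; rewrite m_fun_gfun /gfun -uE tE.
have : ln (1 - 2^-1) < - 2^-1 :> R.
  rewrite -ltr_expR lnK ?posrE; last lra.
  have := @expR_gt1Dx R (- 2^-1); rewrite oppr_eq0 invr_eq0 pnatr_eq0 => /(_ isT).
  lra.
lra.
Qed.

(* With [v = 2 t u (y - u)], [gfun t y - gfun t u = k v^2 + v + ln (1 - v)]. *)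
Let k := (1 - u) / (2 * u).
Let v y := 2 * t * u * (y - u).

Lemma gfun_shift y : y < 1 ->
  gfun t y = gfun t u + (k * v y ^+ 2 + v y + ln (1 - v y)).
Proof.
move=> y1; have /andP[u1 u2] := cond_frac_itv; have e := cond_frac_eq.
have tu : 2 * t * u = (1 - u)^-1.
  by apply: (mulIf (x := 1 - u)); rewrite ?mulVf ?gt_eqF//; lra.
have vE : 1 - v y = (1 - y) / (1 - u).
  by rewrite /v tu; field; rewrite gt_eqF//; lra.
rewrite /gfun vE ln_div ?posrE; try lra.
have tE : t = ((1 - u) * (2 * u))^-1.
  by rewrite invfM -tu; field; rewrite gt_eqF//; lra.
have -> : k * v y ^+ 2 + v y = t * (y ^+ 2 - u ^+ 2).
  rewrite /v tu /k tE; field.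
  by apply/andP; split; rewrite gt_eqF//; lra.
lra.
Qed.

Lemma k_itv : 0 < k /\ (2^-1 <= u -> k <= 2^-1) /\ (2^-1 < u -> k < 2^-1).
Proof.
have /andP[u1 u2] := cond_frac_itv.
split; first by rewrite divr_gt0; lra.
by split => uu; rewrite /k ?ler_pdivrMr ?ltr_pdivrMr; lra.
Qed.

(** Right of [u], [ln1B_le] and [k <= 2^-1] suffice. Left of [u], the condition of [phi_le0] reads
    [1 - u <= y], where [1 - u] is the other critical point, and [2^-1 <= y] implies it. *)
Lemma gfun_le_m y : 2^-1 <= y < 1 -> gfun t y <= m_fun t.
Proof.
move=> /andP[y1 y2]; have /andP[u1 u2] := cond_frac_itv; have e := cond_frac_eq.
have [k0 [kh _]] := k_itv.
have t0 : 0 < t by move: t2; lra.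
have u0 : 0 < u by lra.
have tu0 : 0 < 2 * t * u by rewrite !mulr_gt0.
rewrite m_fun_gfun gfun_shift// gerDl.
have tu : 2 * t * u = (1 - u)^-1.
  by apply: (mulIf (x := 1 - u)); rewrite ?mulVf ?gt_eqF//; lra.
have [uy|yu] := lerP u y.
  have v0 : 0 <= v y by rewrite /v (pmulr_rge0 _ tu0) subr_ge0.
  have v1 : v y < 1 by rewrite /v tu mulrC ltr_pdivrMr; lra.
  have := @ln1B_le (v y); rewrite v0 v1 => /(_ isT).
  have := ler_wpM2r (sqr_ge0 (v y)) (kh u1); lra.
have v0 : 0 <= - v y by rewrite /v -mulrN (pmulr_rge0 _ tu0); lra.
have := @phi_le0 k (- v y); rewrite sqrrN opprK; apply => //.
rewrite /k /v tu.
have -> : 2 * ((1 - u) / (2 * u)) * (1 - (1 - u)^-1 * (y - u)) = (1 - y) / u.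
  by field; rewrite !gt_eqF//; lra.
rewrite ler_pdivrMr; lra.
Qed.

(** On the right of [u] the quadratic gain comes from [k < 2^-1]. On the left, [phi_le_max] reduces
    the claim to the endpoint [y0 = (2 t)^-1], where the rate is negative, hence below [m_fun t] by
    a definite amount. *)
Lemma gfun_gap : 0 <= m_fun t -> exists2 c, 0 < c &
  forall y, (2 * t)^-1 <= y < 1 -> gfun t y <= m_fun t - c * (y - u) ^+ 2.
Proof.
move=> m0; have /andP[u1 u2] := cond_frac_itv; have e := cond_frac_eq.
have uh := cond_frac_gt_half m0.
have [k0 [_ /(_ uh) kh]] := k_itv.
have t0 : 0 < t by move: t2; lra.
have u0 : 0 < u by lra.
have tu0 : 0 < 2 * t * u by rewrite !mulr_gt0.
have tu : 2 * t * u = (1 - u)^-1.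
  by apply: (mulIf (x := 1 - u)); rewrite ?mulVf ?gt_eqF//; lra.
pose y0 := (2 * t)^-1; pose w1 := - v y0.
have y00 : 0 < y0 by rewrite invr_gt0 mulr_gt0.
have ty0 : t * y0 = 2^-1 by rewrite /y0; field; rewrite gt_eqF.
have y0u : y0 < u.
  have : y0 = u * (1 - u).
    have t20 : 2 * t != 0 by rewrite gt_eqF// mulr_gt0.
    by apply: (mulfI t20); rewrite /y0 divff// mulrA e.
  by move=> ->; rewrite gtr_pMr; lra.
have g0 : gfun t y0 <= - (y0 / 2).
  have := @le_ln_sub1 (1 - y0) ltac:(lra); rewrite /gfun expr2 mulrA ty0; lra.
have w10 : 0 < w1 by rewrite /w1 /v -mulrN mulr_gt0//; lra.
have p1 : k * w1 ^+ 2 - w1 + ln (1 + w1) <= - (y0 / 2).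
  have := @gfun_shift y0 ltac:(lra); rewrite -m_fun_gfun /w1 sqrrN opprK => h; lra.
(* The two slacks: of [k] below [2^-1], and of the rate at [y0] in units of [w1 ^+ 2]. *)
pose c' := Num.min ((2^-1 - k)) (y0 / 2 / w1 ^+ 2).
have c'0 : 0 < c' by rewrite lt_min subr_gt0 kh !divr_gt0// exprn_gt0.
have c'1 : k + c' <= 2^-1 by rewrite -lerBrDl ge_min lexx.
have c'2 : c' * w1 ^+ 2 <= y0 / 2.
  by rewrite -ler_pdivlMr ?exprn_gt0// ge_min lexx orbT.
exists (c' * (2 * t * u) ^+ 2); first by rewrite mulr_gt0// exprn_gt0.
move=> y /andP[yy0 y1].
have -> : c' * (2 * t * u) ^+ 2 * (y - u) ^+ 2 = c' * v y ^+ 2.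
  by rewrite /v; ring.
rewrite m_fun_gfun gfun_shift// lerD2l.
suff : (k + c') * v y ^+ 2 + v y + ln (1 - v y) <= 0 by lra.
have [uy|yu] := lerP u y.
  have v0 : 0 <= v y by rewrite /v (pmulr_rge0 _ tu0) subr_ge0.
  have v1 : v y < 1 by rewrite /v tu mulrC ltr_pdivrMr; lra.
  have := @ln1B_le (v y); rewrite v0 v1 => /(_ isT).
  have := ler_wpM2r (sqr_ge0 (v y)) c'1; lra.
have v0 : 0 <= - v y by rewrite /v -mulrN (pmulr_rge0 _ tu0); lra.
have vw : - v y <= w1 by rewrite /w1 lerN2 /v ler_pM2l// lerD2r.
have vw' : 0 <= - v y <= w1 by rewrite v0 vw.
have kc0 : 0 < k + c' by rewrite addr_gt0.
have := phi_le_max vw' kc0 ltac:(lra).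
by rewrite -[(- v y) ^+ 2]/((- v y) * (- v y)) mulrNN opprK.
Qed.
End at_t.

(** [m_fun] is the maximum over [y >= 2^-1] of rates strictly increasing in [t]; compare at the
    maximiser for the smaller parameter. *)
Lemma m_fun_lt t t' : 2 <= t -> t < t' -> m_fun t < m_fun t'.
Proof.
move=> t2 tt'; have /andP[u1 u2] := cond_frac_itv t2.
have t'2 : 2 <= t' by lra.
have := @gfun_le_m _ t'2 (cond_frac t); rewrite u1 u2 => /(_ isT).
apply: lt_le_trans; rewrite (m_fun_gfun t2) /gfun ltrD2r ltr_pM2r//.
by rewrite exprn_gt0//; lra.
Qed.

End free_energy.

(** * Existence of the critical value *)

Section free_energy.
Import numFieldNormedType.Exports.
Context {R : realType}.
Lemma m_fun_root : exists t : R, 2 <= t /\ m_fun t = 0.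
Proof.
have m2 : m_fun 2 < 0 :> R.
  rewrite ltNge; apply/negP => /(cond_frac_gt_half (lexx 2)).
  by rewrite /cond_frac divff// subrr sqrtr0 addr0 mul1r ltxx.
have m8 : 0 < m_fun 8 :> R.
  have t2 : 2 <= 8 :> R by lra.
  (* The trial fraction [3 / 4] has rate [9 / 2 - 2 ln 2 > 0] at [t = 8]. *)
  have h34 : 2^-1 <= (3 / 4 : R) < (1 : R) by apply/andP; split; lra.
  have := gfun_le_m t2 h34.
  apply: lt_le_trans; rewrite /gfun.
  have -> : 1 - 3 / 4 = (2 ^+ 2)^-1 :> R by field.
  rewrite lnV ?posrE ?exprn_gt0// lnXn//.
  have := @le_ln_sub1 R 2 ltac:(lra); lra.
have [|||t] := @IVT R (@m_fun R) 2 8 0.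
- lra.
- apply: continuous_in_subspaceT => x; rewrite inE/= in_itv/= => /andP[x2 _].
  have x0 : x != 0 by rewrite gt_eqF//; lra.
  have cV : {for x, continuous (fun z : R => 2 / z)}.
    by apply: cvgM; [exact: cvg_cst|exact: cvgV].
  have cs : {for x, continuous (fun z : R => Num.sqrt (1 - 2 / z))}.
    apply: (continuous_comp (f := fun z : R => 1 - 2 / z)); last exact: sqrt_continuous.
    by apply: cvgB => //; exact: cvg_cst.
  have ch : {for x, continuous (fun z : R => z / 2)}.
    by apply: cvgM => //; exact: cvg_cst.
  apply: cvgD.
    apply: cvgD; last exact: cvgM.
    by apply: cvgB => //; exact: cvg_cst.
  apply: (continuous_comp (f := fun z : R => 2^-1 - 2^-1 * Num.sqrt (1 - 2 / z))).
    apply: cvgB; first exact: cvg_cst.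
    by apply: cvgM => //; exact: cvg_cst.
  apply: continuous_ln; have /andP[_] := cond_frac_itv x2.
  rewrite /cond_frac; lra.
- have m28 : m_fun 2 <= m_fun 8 :> R by exact: ltW (lt_trans m2 m8).
  by rewrite min_l// max_r// !ltW.
- rewrite in_itv/= => /andP[t2 _] m0; by exists t.
Qed.

End free_energy.

(** * Gaps of the rate function in the three phases *)

Section free_energy.
Context {R : realType}.
Implicit Types (t y : R).

(** The root found above rules out the default value [0] of [xget]. *)
Lemma theta_cP : 2 <= theta_c R /\ m_fun (theta_c R) = 0.
Proof. exact: (@xgetPex _ 0 [set t : R | 2 <= t /\ m_fun t = 0] m_fun_root). Qed.

(** For small fractions the entropy loss [ln (1 - y) <= - y] beats the energy gain
    [t y^2 <= y / 2]. *)
Lemma gfun_small t y : 0 <= y < 1 -> t * y <= 2^-1 -> gfun t y <= - (y / 2).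
Proof.
move=> /andP[y0 y1] ty; have := @le_ln_sub1 R (1 - y) ltac:(lra).
have := ler_wpM2r y0 ty; rewrite /gfun -mulrA -expr2; lra.
Qed.

Lemma gfun_above t y : 0 <= m_fun t -> 2 <= t -> 0 <= y < 1 -> gfun t y <= m_fun t.
Proof.
move=> m0 t2 y01; have /andP[y0 y1] := y01.
have t0 : 0 < t by lra.
have [c c0 gc] := gfun_gap t2 m0.
have [ty|ty] := lerP (t * y) 2^-1.
  by apply: le_trans m0; have := gfun_small y01 ty; lra.
have hy : (2 * t)^-1 <= y by rewrite invfM ler_pdivrMr// mulrC ltW.
have := gc y; rewrite hy y1 => /(_ isT).
have := mulr_ge0 (ltW c0) (sqr_ge0 (y - cond_frac t)); lra.
Qed.

(** At [theta_c] the rate is nowhere positive. Lowering the parameter to [t] gains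
    [(theta_c - t) y^2], which is linear in [y] once [y >= (2 theta_c)^-1]; smaller [y] fall under
    [gfun_small]. *)
Lemma gfun_sub t : 0 <= t < theta_c R -> exists2 c, 0 < c &
  forall y, 0 <= y < 1 -> gfun t y <= - (c * y).
Proof.
have [tc2 mtc] := theta_cP; set tc := theta_c R in tc2 mtc *.
move=> /andP[t0 ttc].
exists (Num.min 2^-1 ((tc - t) / (2 * tc))).
  by rewrite lt_min invr_gt0 ltr0n/= divr_gt0//; lra.
move=> y y01; have /andP[y0 y1] := y01.
have [ty|ty] := lerP (t * y) 2^-1.
  apply: le_trans (gfun_small y01 ty) _; rewrite lerN2 mulrC ler_wpM2l//.
  by rewrite ge_min lexx.
have tcy : 2^-1 < tc * y.
  by apply: lt_le_trans ty _; rewrite ler_wpM2r// ltW.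
have := @gfun_above tc y ltac:(by rewrite mtc) tc2 y01.
rewrite mtc => g0.
have -> : gfun t y = gfun tc y - (tc - t) * y ^+ 2 by rewrite /gfun; ring.
have h : (tc - t) / (2 * tc) * y <= (tc - t) * y ^+ 2.
  rewrite -mulrA ler_wpM2l//; first lra.
  have hy : (2 * tc)^-1 <= y by rewrite invfM ler_pdivrMr; lra.
  by rewrite expr2 ler_wpM2r.
have : Num.min 2^-1 ((tc - t) / (2 * tc)) * y <= (tc - t) / (2 * tc) * y.
  by rewrite ler_wpM2r// ge_min lexx orbT.
lra.
Qed.

(** There are two maximisers: the cost is linear near [0] and quadratic near [cond_frac t], whence
    the minimum. *)
Lemma gfun_crit t : 2 <= t -> m_fun t = 0 -> exists2 c, 0 < c &
  forall y, 0 <= y < 1 -> gfun t y <= - (c * Num.min y ((y - cond_frac t) ^+ 2)).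
Proof.
move=> t2 mt; have t0 : 0 < t by lra.
have [c c0 gc] := gfun_gap t2 ltac:(by rewrite mt).
exists (Num.min 2^-1 c); first by rewrite lt_min c0 invr_gt0 ltr0n.
move=> y y01; have /andP[y0 y1] := y01.
set d := (y - _) ^+ 2; have d0 : 0 <= d by exact: sqr_ge0.
have [ty|ty] := lerP (t * y) 2^-1.
  apply: le_trans (gfun_small y01 ty) _; rewrite lerN2 mulrC.
  by apply: ler_pM; rewrite ?le_min ?y0 ?d0 ?ge_min ?lexx ?invr_ge0 ?ler0n ?(ltW c0).
have hy : (2 * t)^-1 <= y by rewrite invfM ler_pdivrMr// mulrC ltW.
have := gc y; rewrite hy y1 => /(_ isT).
rewrite mt sub0r => /le_trans; apply; rewrite lerN2.
by apply: ler_pM; rewrite ?le_min ?y0 ?d0 ?ge_min ?lexx ?orbT ?invr_ge0 ?ler0n ?(ltW c0).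
Qed.

(** For small [y] the whole gap [m_fun t] is available, and it suffices because the squared distance
    is at most [1]. *)
Lemma gfun_super t : theta_c R < t -> 0 < m_fun t /\ exists2 c, 0 < c &
  forall y, 0 <= y < 1 -> gfun t y <= m_fun t - c * (y - cond_frac t) ^+ 2.
Proof.
have [tc2 mtc] := theta_cP => tct.
have t2 : 2 <= t by lra.
have t0 : 0 < t by lra.
have m0 : 0 < m_fun t by rewrite -mtc; exact: m_fun_lt.
split => //.
have [c c0 gc] := gfun_gap t2 (ltW m0).
exists (Num.min (m_fun t) c); first by rewrite lt_min c0 m0.
move=> y y01; have /andP[y0 y1] := y01.
have /andP[u1 u2] := cond_frac_itv t2.
set d := (y - _) ^+ 2; have d0 : 0 <= d by exact: sqr_ge0.
have [ty|ty] := lerP (t * y) 2^-1.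
  apply: (@le_trans _ _ 0); first by have := gfun_small y01 ty; lra.
  rewrite subr_ge0 -[leRHS]mulr1; apply: ler_pM; rewrite ?ge_min ?lexx ?le_min ?(ltW c0) ?(ltW m0)//.
  by rewrite /d expr2; nra.
have hy : (2 * t)^-1 <= y by rewrite invfM ler_pdivrMr// mulrC ltW.
have := gc y; rewrite hy y1 => /(_ isT).
move=> /le_trans; apply; rewrite lerD2l lerN2 ler_wpM2r//.
by rewrite ge_min lexx orbT.
Qed.
End free_energy.

(** * Domination by Gaussian products *)

Section upper_bound.
Context {R : realType} {V : finType}.
Implicit Types (f : V -> R * R) (L B beta g l y : R) (z : R * R).
Local Notation n := (@nV R V).

Definition peaks L f : {set V} := [set x | L < abs2 (f x)].
Definition peak_mass L f := \sum_(x in peaks L f) abs2 (f x).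
Definition peak_sq L f := \sum_(x in peaks L f) abs2 (f x) ^+ 2.
Definition bulk_sq L f := \sum_(x | x \notin peaks L f) abs2 (f x) ^+ 2.

Lemma abs2_ge0 z : 0 <= abs2 z.
Proof. by rewrite /abs2 addr_ge0 ?sqr_ge0. Qed.

Lemma Nf_ge0 f : 0 <= Nf f.
Proof. by apply: sumr_ge0 => x _; exact: abs2_ge0. Qed.

Lemma abs2_le_Nf f x : abs2 (f x) <= Nf f.
Proof.
rewrite /Nf (bigD1 x)//= lerDl sumr_ge0// => y _; exact: abs2_ge0.
Qed.

Lemma sum_peaks L f (F : V -> R) :
  \sum_x F x = \sum_(x in peaks L f) F x + \sum_(x | x \notin peaks L f) F x.
Proof. by rewrite (bigID (mem (peaks L f))). Qed.

Lemma card_peaks L f : #|peaks L f|%:R * L <= peak_mass L f.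
Proof.
rewrite mulr_natl -sumr_const; apply: ler_sum => x; rewrite inE => /ltW; exact.
Qed.

(* Dominates [exp (g X^2 - l X)], [X = abs2 z], as long as [g X <= l / 2]. *)
Definition bulk_kernel g l z := gauss l z + 32 * g / l ^+ 2 * gauss (l / 4) z.

(** Use [exp a <= 1 + a exp a] with [a = g X^2], then [a <= l X / 2] in the exponent and
    [X^2 <= 32 / l^2 * exp (l X / 4)]. A quarter of the decay survives, and the correction stays
    proportional to [g]. *)
Lemma bulk_kernel_ge g l z : 0 < l -> 0 <= g -> g * abs2 z <= l / 2 ->
  expR (g * abs2 z ^+ 2 - l * abs2 z) <= bulk_kernel g l z.
Proof.
move=> l0 g0; rewrite /bulk_kernel /gauss; have := abs2_ge0 z.
move: (abs2 z) => X X0 gX.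
have h1 : expR (g * X ^+ 2) <= 1 + g * X ^+ 2 * expR (l / 2 * X).
  have a0 : 0 <= g * X ^+ 2 by rewrite mulr_ge0 ?sqr_ge0.
  have : expR (g * X ^+ 2) <= 1 + g * X ^+ 2 * expR (g * X ^+ 2).
    have := expR_ge1Dx (- (g * X ^+ 2)).
    move=> /(ler_wpM2r (expR_ge0 (g * X ^+ 2))).
    by rewrite -expRD addNr expR0; lra.
  move=> /le_trans; apply; rewrite lerD2l ler_wpM2l// ler_expR expr2 mulrA.
  by rewrite ler_wpM2r.
have h2 : X ^+ 2 <= 32 / l ^+ 2 * expR (l / 4 * X).
  have a0 : 0 <= l / 4 * X by rewrite !mulr_ge0// ltW.
  have := expR_ge1Dxn 1 a0; rewrite [X in 1 + _ ^+ 2 / X](_ : _ = 2 :> R)// => h.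
  have {}h : (l / 4 * X) ^+ 2 <= 2 * expR (l / 4 * X) by move: h; lra.
  rewrite mulrAC ler_pdivlMr ?exprn_gt0//; move: h.
  have -> : (l / 4 * X) ^+ 2 = X ^+ 2 * l ^+ 2 / 16 by field.
  lra.
rewrite expRD; apply: le_trans (ler_wpM2r (expR_ge0 _) h1) _.
rewrite mulrDl mul1r lerD2l.
set E1 := expR (l / 2 * X); set E2 := expR (- (l * X)).
have -> : expR (- (l / 4 * X)) = expR (l / 4 * X) * (E1 * E2).
  by rewrite /E1 /E2 -!expRD; congr expR; field.
have -> : g * X ^+ 2 * E1 * E2 = g * (E1 * E2) * X ^+ 2 by ring.
have -> : 32 * g / l ^+ 2 * (expR (l / 4 * X) * (E1 * E2)) =
  g * (E1 * E2) * (32 / l ^+ 2 * expR (l / 4 * X)) by ring.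
by rewrite ler_wpM2l// !mulr_ge0// expR_ge0.
Qed.

(** The Gaussian is so wide that [expR 1] compensates its decay up to [abs2 z = B * n]. Of the three
    powers of [n], one pays for this width, one for [1 - y >= n^-1] and one for the number of
    sites. *)
Definition peak_kernel B z := n ^- 3 * expR 1 * gauss (B * n)^-1 z.

Lemma peak_kernel_ge B z : 0 < n -> 0 < B -> abs2 z <= B * n ->
  expR (- (3 * ln n)) <= peak_kernel B z.
Proof.
move=> n0 B0 zB; rewrite /peak_kernel /gauss -mulrA -expRD.
have -> : expR (- (3 * ln n)) = n ^- 3.
  by rewrite expRN mulr_natl -lnXn// lnK// posrE exprn_gt0.
rewrite -[leLHS]mulr1 ler_wpM2l ?invr_ge0 ?exprn_ge0 ?(ltW n0)//.
by rewrite -[leLHS]expR0 ler_expR subr_ge0 mulrC ler_pdivrMr ?mul1r ?mulr_gt0.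
Qed.

(** With a sum of the two kernels, expanding the product over sites covers all peak sets at once.
    The bulk rate is the inverse of [B * (1 - y)], the mean mass per site left to the bulk. *)
Definition site_kernel g B y z := bulk_kernel g (B * (1 - y))^-1 z + peak_kernel B z.

Definition site_kernel_int g B y : R :=
  pi / (B * (1 - y))^-1 + 32 * g / (B * (1 - y))^-1 ^+ 2 * (pi / ((B * (1 - y))^-1 / 4))
  + n ^- 3 * expR 1 * (pi / (B * n)^-1).

Section kernel_lemmas.
Variables (g B y : R).
Hypotheses (n1 : 1 <= n) (B0 : 0 < B) (g0 : 0 <= g) (y01 : 0 <= y <= 1 - n^-1).

Let n0 : 0 < n. Proof. exact: lt_le_trans n1. Qed.
Let r0 : 0 < 1 - y.
Proof.
have ni : 0 < n^-1 by rewrite invr_gt0 n0.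
by move: y01; lra.
Qed.

Lemma peak_kernel_ge0 z : 0 <= peak_kernel B z.
Proof.
rewrite /peak_kernel mulr_ge0 ?gauss_ge0// mulr_ge0 ?expR_ge0//.
by rewrite invr_ge0 exprn_ge0// ltW.
Qed.

Lemma bulk_kernel_ge0 l z : 0 <= bulk_kernel g l z.
Proof.
by rewrite addr_ge0 ?gauss_ge0// mulr_ge0 ?gauss_ge0// mulr_ge0 ?mulr_ge0// invr_ge0 sqr_ge0.
Qed.

Lemma site_kernel_ge0 z : 0 <= site_kernel g B y z.
Proof. by rewrite addr_ge0 ?bulk_kernel_ge0 ?peak_kernel_ge0. Qed.

Lemma measurable_site_kernel : measurable_fun setT (site_kernel g B y).
Proof.
apply: measurable_funD; first apply: measurable_funD.
- exact: measurable_gauss.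
- by apply: measurable_funM => //; exact: measurable_gauss.
- by apply: measurable_funM => //; exact: measurable_gauss.
Qed.

Lemma plane_integral_kernel :
  plane_integral (site_kernel g B y) = (site_kernel_int g B y)%:E.
Proof.
have l0 : 0 < (B * (1 - y))^-1 by rewrite invr_gt0 mulr_gt0// r0.
have k0 : 0 <= 32 * g / (B * (1 - y))^-1 ^+ 2.
  by rewrite !mulr_ge0// invr_ge0 sqr_ge0.
have e0 : 0 <= n ^- 3 * expR 1.
  by rewrite mulr_ge0 ?expR_ge0// invr_ge0 exprn_ge0// ltW ?n0.
have mg l : measurable_fun setT (gauss l : R * R -> R) by exact: measurable_gauss.
apply: plane_integralD.
- apply: measurable_funD => //; exact: measurable_funM.
- exact: measurable_funM.
- exact: bulk_kernel_ge0.
- exact: peak_kernel_ge0.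
- apply: plane_integralD => //.
  + exact: measurable_funM.
  + by move=> z; rewrite gauss_ge0.
  + by move=> z; rewrite mulr_ge0 ?gauss_ge0.
  + exact: plane_integral_gauss.
  + apply: plane_integralZ => //; first by move=> z; rewrite gauss_ge0.
    by apply: plane_integral_gauss; rewrite divr_gt0.
- apply: plane_integralZ => //; first by move=> z; rewrite gauss_ge0.
  by apply: plane_integral_gauss; rewrite invr_gt0 mulr_gt0// n0.
Qed.

Lemma kernel_int_ge0 : 0 <= site_kernel_int g B y.
Proof.
rewrite -lee_fin -plane_integral_kernel.
by apply: integral_ge0 => a _; apply: integral_ge0 => b _; rewrite lee_fin site_kernel_ge0.
Qed.

(** Factoring out [1 - y] and using [1 + x <= exp x] prepares the [n]-th power: for [g] of order
    [1 / L] the extra factor becomes [exp (O (n / L))]. *)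
Lemma kernel_int_le :
  site_kernel_int g B y <= pi * B * ((1 - y) * expR (128 * g * B ^+ 2 + expR 1 / n)).
Proof.
have -> : site_kernel_int g B y = pi * B * ((1 - y) +
    128 * g * B ^+ 2 * (1 - y) ^+ 3 + expR 1 / n ^+ 2).
  by rewrite /site_kernel_int; field; rewrite !gt_eqF// ?n0 ?r0.
rewrite ler_wpM2l ?mulr_ge0 ?pi_ge0 ?(ltW B0)//.
apply: le_trans (ler_wpM2l (ltW r0) (expR_ge1Dx _)).
have h1 : 128 * g * B ^+ 2 * (1 - y) ^+ 3 <= 128 * g * B ^+ 2 * (1 - y).
  apply: ler_wpM2l; first by rewrite mulr_ge0 ?sqr_ge0// mulr_ge0.
  have r1 : 1 - y <= 1 by move: y01; lra.
  by rewrite exprS ler_piMr ?exprn_ile1 ?(ltW r0).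
have h2 : expR 1 / n ^+ 2 <= (1 - y) * (expR 1 / n).
  have -> : expR 1 / n ^+ 2 = n^-1 * (expR 1 / n) :> R.
    by field; rewrite gt_eqF// n0.
  rewrite ler_wpM2r ?divr_ge0 ?expR_ge0 ?(ltW n0)//.
  by move: y01; lra.
by lra.
Qed.

End kernel_lemmas.

Lemma site_kernel_ge g B y L f x : 1 <= n -> 0 < B -> 0 <= g -> 0 <= y <= 1 - n^-1 ->
  2 * B * g * L <= 1 -> Nf f <= B * n ->
  expR (if x \in peaks L f then - (3 * ln n)
        else g * abs2 (f x) ^+ 2 - (B * (1 - y))^-1 * abs2 (f x))
  <= site_kernel g B y (f x).
Proof.
move=> n1 B0 g0 y01 gL NB.
have n0 : 0 < n by exact: lt_le_trans n1.
have ni : 0 < n^-1 by rewrite invr_gt0.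
have r0 : 0 < 1 - y by move: y01; lra.
rewrite inE; case: ltP => xL.
  apply: (@le_trans _ _ (peak_kernel B (f x))).
    by rewrite peak_kernel_ge// (le_trans _ NB)// abs2_le_Nf.
  by rewrite lerDr bulk_kernel_ge0.
apply: (@le_trans _ _ (bulk_kernel g (B * (1 - y))^-1 (f x))); last first.
  by rewrite lerDl peak_kernel_ge0.
apply: bulk_kernel_ge => //; first by rewrite invr_gt0 mulr_gt0.
apply: (@le_trans _ _ (g * L)); first by rewrite ler_wpM2l.
rewrite -invfM -[leRHS]mul1r ler_pdivlMr ?mulr_gt0//.
apply: le_trans gL.
have -> : 2 * B * g * L = g * L * (B * 2) by ring.
have h : 0 <= L by exact: le_trans (abs2_ge0 _) xL.
rewrite ler_wpM2l ?mulr_ge0// -mulrA ler_wpM2l ?(ltW B0)//.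
by move: y01; lra.
Qed.

(* The price, on the exponential scale, of distributing the peak mass over
   several sites, of missing mass, and of a bulk with a large sum of squares. *)
Definition deviation beta B L f :=
  beta / n * (peak_mass L f ^+ 2 - peak_sq L f) + (B * n - Nf f) / B
  + bulk_sq L f / (4 * B * L).

(** The exponents of the site bounds add up. Every peak loses [3 ln n], and there are at most
    [B n / L] of them. The excess [(4 B L)^-1] of the kernel parameter over [beta / n] yields the
    bulk term of [deviation]; replacing [peak_sq] by [peak_mass ^+ 2] yields its first term. *)
Lemma prod_kernel_ge beta B L y f : 1 <= n -> 0 < B -> 0 <= beta -> 0 < L ->
  4 * B * beta * L <= n -> 0 <= y <= 1 - n^-1 -> Nf f <= B * n ->
  y <= peak_mass L f / (B * n) <= y + n^-1 ->
  expR (beta / n * \sum_x abs2 (f x) ^+ 2) <=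
  expR (n * (1 + beta * B ^+ 2 * y ^+ 2) + 3 * (beta * B ^+ 2)
        + 3 * ln n * (B * n / L) - deviation beta B L f) *
  \prod_x site_kernel (beta / n + (4 * B * L)^-1) B y (f x).
Proof.
move=> n1 B0 b0 L0 bL y01 NB yY.
have n0 : 0 < n by exact: lt_le_trans n1.
have ni : 0 < n^-1 by rewrite invr_gt0.
have r0 : 0 < 1 - y by move: y01; lra.
set g := beta / n + (4 * B * L)^-1.
have g0 : 0 <= g by rewrite addr_ge0 ?divr_ge0 ?invr_ge0 ?mulr_ge0// ?(ltW B0) ?(ltW L0) ?(ltW n0).
have gL : 2 * B * g * L <= 1.
  have -> : 2 * B * g * L = 2 * B * beta * L / n + 2^-1.
    by rewrite /g; field; rewrite !gt_eqF.
  have : 2 * B * beta * L / n <= 2^-1 by rewrite ler_pdivrMr//; lra.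
  lra.
set ex := fun x => if x \in peaks L f then - (3 * ln n)
        else g * abs2 (f x) ^+ 2 - (B * (1 - y))^-1 * abs2 (f x).
apply: (@le_trans _ _ (expR (n * (1 + beta * B ^+ 2 * y ^+ 2) + 3 * (beta * B ^+ 2)
        + 3 * ln n * (B * n / L) - deviation beta B L f) * \prod_x expR (ex x))); last first.
  rewrite ler_wpM2l ?expR_ge0//; apply: ler_prod => x _.
  by rewrite expR_ge0; exact: site_kernel_ge.
rewrite -expR_sum -expRD ler_expR.
rewrite (sum_peaks L f ex) (sum_peaks L f (fun x => abs2 (f x) ^+ 2)).
have -> : \sum_(x in peaks L f) ex x = - (3 * ln n * #|peaks L f|%:R).
  rewrite (eq_bigr (fun=> - (3 * ln n))); last by move=> x xA; rewrite /ex xA.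
  by rewrite sumr_const -mulr_natr; ring.
have -> : \sum_(x | x \notin peaks L f) ex x =
    g * bulk_sq L f - (B * (1 - y))^-1 * (Nf f - peak_mass L f).
  rewrite (eq_bigr (fun x => g * abs2 (f x) ^+ 2 - (B * (1 - y))^-1 * abs2 (f x))); last first.
    by move=> x /negbTE xA; rewrite /ex xA.
  rewrite sumrB -!mulr_sumr /Nf (sum_peaks L f (fun x => abs2 (f x))).
  by rewrite -/(peak_mass L f) addrAC subrr add0r.
rewrite -/(peak_sq L f) -/(bulk_sq L f) /deviation.
set S2A := peak_sq L f; set S2c := bulk_sq L f.
have SAN : peak_mass L f <= Nf f.
  rewrite /Nf (sum_peaks L f (fun x => abs2 (f x))) lerDl sumr_ge0// => x _.
  exact: abs2_ge0.
have SA0 : 0 <= peak_mass L f by apply: sumr_ge0 => x _; exact: abs2_ge0.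
have kL : 3 * ln n * #|peaks L f|%:R <= 3 * ln n * (B * n / L).
  rewrite ler_wpM2l ?mulr_ge0 ?ln_ge0// ler_pdivlMr//.
  by apply: le_trans (card_peaks L f) _; exact: le_trans SAN NB.
move: SAN SA0 yY; set SA := peak_mass L f => SAN SA0.
set Y := SA / (B * n) => yY.
have SAE : SA = B * n * Y by rewrite /Y; field; rewrite !gt_eqF.
have main : beta / n * SA ^+ 2 <=
    n + n * (beta * B ^+ 2 * y ^+ 2) + 3 * (beta * B ^+ 2)
    - (B * n - Nf f) / B - (B * (1 - y))^-1 * (Nf f - SA).
  have -> : beta / n * SA ^+ 2 = n * (beta * B ^+ 2) * Y ^+ 2.
    by rewrite SAE; field; rewrite gt_eqF.
  (* Rounding [Y] down to [y] changes [n Y^2] by at most [2 y + n^-1 <= 3]. *)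
  have Y2 : n * Y ^+ 2 <= n * y ^+ 2 + 3.
    have nni : n * n^-1 = 1 by rewrite divff// gt_eqF.
    have : Y ^+ 2 <= (y + n^-1) ^+ 2.
      by rewrite !expr2; apply: ler_pM; move: y01 yY; lra.
    move=> /(ler_wpM2l (ltW n0)) /le_trans; apply.
    have -> : n * (y + n^-1) ^+ 2 = n * y ^+ 2 + 2 * y * (n * n^-1) + n^-1 * (n * n^-1) by ring.
    rewrite nni; move: y01; lra.
  have t0 : 0 <= beta * B ^+ 2 by rewrite mulr_ge0// sqr_ge0.
  have := ler_wpM2l t0 Y2.
  (* The tilt is charged against the true bulk mass; since [Y >= y] and [Nf f <= B n], what remains
     of [n] pays for the missing mass. *)
  have : 0 <= n - (B * n - Nf f) / B - (B * (1 - y))^-1 * (Nf f - SA).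
    have -> : n - (B * n - Nf f) / B - (B * (1 - y))^-1 * (Nf f - SA) =
       (SA - y * Nf f) / (B * (1 - y)) by field; rewrite !gt_eqF.
    apply: divr_ge0; last by rewrite mulr_ge0// ltW.
    rewrite subr_ge0 SAE [leRHS]mulrC; apply: ler_pM => //; first by move: y01; lra.
      exact: Nf_ge0.
    by move: yY; lra.
  lra.
have -> : S2c / (4 * B * L) = (4 * B * L)^-1 * S2c by rewrite mulrC.
rewrite /g; lra.
Qed.
End upper_bound.

(** * Summing over the grid of condensate fractions *)

Section dominating.
Context {R : realType} {V : finType}.
Implicit Types (f : V -> R * R) (L B beta g l y : R) (z : R * R).
Local Notation n := (@nV R V).

Lemma grid_itv (j : 'I_#|V|) : 0 <= j%:R / n <= 1 - n^-1.
Proof.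
have n0 : 0 < n by rewrite ltr0n (leq_trans _ (ltn_ord j)).
rewrite divr_ge0 ?ler0n//= ler_pdivrMr// mulrBl mul1r mulVf ?gt_eqF//.
by rewrite lerBrDr natr1 ler_nat ltn_ord.
Qed.

Lemma grid_floor (Y : R) : (0 < #|V|)%N -> 0 <= Y <= 1 ->
  exists2 j : 'I_#|V|, 0 <= j%:R / n <= 1 - n^-1 & j%:R / n <= Y <= j%:R / n + n^-1.
Proof.
move=> V0 /andP[Y0 Y1]; have n0 : 0 < n by rewrite ltr0n.
have ni : 0 < n^-1 by rewrite invr_gt0.
have nY0 : 0 <= n * Y by rewrite mulr_ge0// ltW.
have /andP[k1 k2] := truncn_itv nY0.
set k := Num.truncn (n * Y) in k1 k2.
have [kn|kn] := ltnP k #|V|.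
  exists (Ordinal kn); first exact: grid_itv.
  rewrite /=.
  rewrite ler_pdivrMr// mulrC k1/=.
  rewrite -[X in _ + X]mul1r -mulrDl ler_pdivlMr// mulrC ltW//.
  by rewrite natr1.
(* Only [Y = 1] arrives here. It is assigned to the last grid point, which keeps [1 - y >= n^-1]. *)
have kn' : (#|V|.-1 < #|V|)%N by rewrite prednK.
exists (Ordinal kn'); first exact: grid_itv.
rewrite /=.
have -> : #|V|.-1%:R / n + n^-1 = 1.
  by rewrite -[X in _ + X]mul1r -mulrDl natr1 prednK// divff// gt_eqF.
rewrite Y1 andbT (le_trans (_ : _ <= 1)) //.
  by have /andP[_] := grid_itv (Ordinal kn'); rewrite /=; lra.
rewrite -(ler_pM2l n0) mulr1 (le_trans _ k1)// ler_nat//.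
Qed.

Lemma edge_sum_ge0 (e : rel V) (F : V -> V -> R) : (forall x x', 0 <= F x x') ->
  0 <= edge_sum e F.
Proof.
by move=> F0; rewrite mulr_ge0 ?invr_ge0//; apply: sumr_ge0 => x _; exact: sumr_ge0.
Qed.

Lemma weight_le (e : rel V) h beta B f : 0 <= beta -> Nf f <= B * n ->
  weight e h beta B f <= expR (beta / n * \sum_x abs2 (f x) ^+ 2).
Proof.
move=> b0 NB; rewrite /weight NB mulr1 ler_expR /Hf mulrBr opprB.
have : 0 <= beta * (2 / n * edge_sum e (fun x x' => abs2 (csub (f x) (f x')) / h ^+ 2)).
  apply: mulr_ge0 => //; apply: mulr_ge0; first by rewrite divr_ge0 ?ler0n.
  apply: edge_sum_ge0 => x x'.
  by rewrite divr_ge0 ?abs2_ge0 ?sqr_ge0.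
by rewrite mulrA; lra.
Qed.

(** Off [E] the hypothesis bounds [- deviation] by [n (M - gfun y) - c L], a constant for each grid
    value [y]. Integration contributes [n ln (1 - y)], which cancels the dependence on [y]: all
    terms of [U] get the same bound, and their number costs [ln n]. *)
Lemma dominating_function (e : rel V) (h beta B L M c : R)
    (E : (V -> R * R) -> Prop) :
  1 <= n -> 0 < B -> 0 <= beta -> 0 < L -> 4 * B * beta * L <= n ->
  (forall f y, Nf f <= B * n -> ~ E f -> 0 <= y <= 1 - n^-1 ->
    y <= peak_mass L f / (B * n) <= y + n^-1 ->
    c * L <= n * (M - gfun (beta * B ^+ 2) y) + deviation beta B L f) ->
  exists U u, [/\ forall f, 0 <= U f, rmeas U,
    integral_CV (fun f => (U f)%:E) = u%:E,
    u <= (pi * B) ^+ #|V| * expR (n + n * M + (ln n + 131 * (beta * B ^+ 2) +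
       3 * ln n * (B * n / L) + 32 * (B * n / L) + expR 1) - c * L) &
    forall f, ~ E f -> weight e h beta B f <= U f].
Proof.
move=> n1 B0 b0 L0 bL bad.
have n0 : 0 < n by exact: lt_le_trans n1.
have ni : 0 < n^-1 by rewrite invr_gt0.
have V0 : (0 < #|V|)%N by rewrite -(@ltr0n R).
pose th := beta * B ^+ 2; pose g := beta / n + (4 * B * L)^-1.
have g0 : 0 <= g by rewrite addr_ge0 ?divr_ge0 ?invr_ge0 ?mulr_ge0// ?(ltW B0) ?(ltW L0) ?(ltW n0).
pose yj (j : 'I_#|V|) : R := j%:R / n.
have yj01 j : 0 <= yj j <= 1 - n^-1.
  exact: grid_itv.
pose k j := expR (n * (1 + th * yj j ^+ 2) + 3 * th + 3 * ln n * (B * n / L)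
  + n * (M - gfun th (yj j)) - c * L).
pose F j f := k j * \prod_x @site_kernel R V g B (yj j) (f x).
pose I j := k j * \prod_(x : V) @site_kernel_int R V g B (yj j).
have FP j := @integral_CV_scale_prod R V (fun=> @site_kernel R V g B (yj j))
  (fun=> @site_kernel_int R V g B (yj j)) (k j) (expR_ge0 _)
  (fun _ z => ltac:(exact: site_kernel_ge0)) (fun _ => ltac:(exact: measurable_site_kernel))
  (fun _ => ltac:(exact: plane_integral_kernel)).
exists (fun f => \sum_j F j f), (\sum_j I j); split.
- move=> f; apply: sumr_ge0 => j _; have [F0 _ _] := FP j; exact: F0.
- by apply: rmeas_sum => j; have [_ mF _] := FP j.
- by apply: integral_CV_sum => j; have [F0 mF iF] := FP j.
- have Ij j : I j <= (pi * B) ^+ #|V| * expR (n + n * M + (131 * th +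
       3 * ln n * (B * n / L) + 32 * (B * n / L) + expR 1) - c * L).
    have r0 : 0 < 1 - yj j by have := yj01 j; lra.
    rewrite /I prodr_const cardE -cardT.
    have := kernel_int_le n1 B0 g0 (yj01 j).
    set q := 128 * g * B ^+ 2 + _ => h1.
    have h2 : @site_kernel_int R V g B (yj j) ^+ #|V| <= (pi * B) ^+ #|V| * expR (n * (ln (1 - yj j) + q)).
      have -> : expR (n * (ln (1 - yj j) + q)) = ((1 - yj j) * expR q) ^+ #|V|.
        by rewrite mulrC expRM_natr expRD lnK.
      rewrite -exprMn ler_pXn2r// ?nnegrE ?kernel_int_ge0//.
      by rewrite !mulr_ge0 ?expR_ge0 ?pi_ge0 ?(ltW r0) ?(ltW B0).
    apply: le_trans (ler_wpM2l (expR_ge0 _) h2) _.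
    rewrite mulrCA ler_wpM2l ?exprn_ge0 ?mulr_ge0 ?pi_ge0 ?(ltW B0)//.
    rewrite -expRD ler_expR /gfun.
    have -> : n * (ln (1 - yj j) + q) = n * ln (1 - yj j) + 128 * th + 32 * (B * n / L) + expR 1.
      by rewrite /q /g /th; field; rewrite !gt_eqF.
    lra.
  apply: le_trans (ler_sum _ (fun j _ => Ij j)) _.
  rewrite sumr_const card_ord -[leLHS]mulr_natl mulrCA ler_wpM2l ?exprn_ge0 ?mulr_ge0 ?pi_ge0 ?(ltW B0)//.
  rewrite -[X in X * _](lnK (x := n)) ?posrE// -expRD ler_expR /th.
  lra.
- move=> f Ef; have [NB|NB] := lerP (Nf f) (B * n); last first.
    rewrite /weight ifF ?mulr0; last by apply/negbTE; rewrite -ltNge.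
    apply: sumr_ge0 => j _; have [F0 _ _] := FP j; exact: F0.
  have Y01 : 0 <= peak_mass L f / (B * n) <= 1.
    rewrite divr_ge0 ?mulr_ge0 ?(ltW B0) ?(ltW n0)//=; last first.
      by apply: sumr_ge0 => x _; exact: abs2_ge0.
    rewrite ler_pdivrMr ?mulr_gt0// mul1r (le_trans _ NB)//.
    rewrite /Nf (sum_peaks L f (fun x => abs2 (f x))) lerDl sumr_ge0// => x _.
    exact: abs2_ge0.
  have [j j1 j2] := grid_floor V0 Y01.
  apply: (@le_trans _ _ (F j f)); last first.
    rewrite (bigD1 j)//= lerDl sumr_ge0// => i _; have [F0 _ _] := FP i; exact: F0.
  apply: le_trans (weight_le e h b0 NB) _.
  apply: le_trans (prod_kernel_ge n1 B0 b0 L0 bL j1 NB j2) _.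
  rewrite ler_wpM2r//.
    by apply: prodr_ge0 => x _; exact: site_kernel_ge0.
  rewrite ler_expR -/th; have := bad f _ NB Ef j1 j2; rewrite -/th -/(yj j).
  lra.
Qed.
End dominating.

(** * Lower bound for the partition function *)

Section lower_bound.
Context {R : realType} {V : finType}.
Implicit Types (f : V -> R * R) (B beta y h : R) (e : rel V).
Local Notation n := (@nV R V).

Lemma abs2_csub_le (z w : R * R) : abs2 (csub z w) <= 2 * abs2 z + 2 * abs2 w.
Proof.
rewrite /abs2 /csub/=; have := sqr_ge0 (z.1 + w.1); have := sqr_ge0 (z.2 + w.2); nra.
Qed.

Lemma edge_sum_le e (D : nat) h f : simple_graph e -> (max_degree e <= D)%N ->
  edge_sum e (fun x x' => abs2 (csub (f x) (f x')) / h ^+ 2)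
  <= 2 * D%:R * Nf f / h ^+ 2.
Proof.
move=> [esym _] degD.
have deg x : (degree e x <= D)%N.
  by apply: leq_trans degD; exact: (leq_bigmax x).
have S x (F : R) : 0 <= F -> \sum_(x' | e x x') F <= D%:R * F.
  move=> F0; rewrite sumr_const -[leLHS]mulr_natl ler_wpM2r// ler_nat.
  by apply: leq_trans (deg x); rewrite /degree cardsE.
have h0 : 0 <= (h ^+ 2)^-1 by rewrite invr_ge0 sqr_ge0.
rewrite /edge_sum.
have -> : 2 * D%:R * Nf f / h ^+ 2 = 2^-1 * (4 * D%:R * Nf f * (h ^+ 2)^-1).
  by move: (h ^+ 2)^-1 => c; field.
rewrite ler_wpM2l ?invr_ge0//.
under eq_bigr => x _ do rewrite -mulr_suml.
rewrite -mulr_suml ler_wpM2r//.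
apply: (@le_trans _ _ (\sum_x \sum_(x' | e x x') (2 * abs2 (f x)) +
    \sum_x \sum_(x' | e x x') (2 * abs2 (f x')))).
  rewrite -big_split/=; apply: ler_sum => x _; rewrite -big_split/=.
  by apply: ler_sum => x' _; exact: abs2_csub_le.
have -> : \sum_x \sum_(x' | e x x') (2 * abs2 (f x')) =
    \sum_x \sum_(x' | e x x') (2 * abs2 (f x)).
  rewrite (exchange_big_dep predT)//=; apply: eq_bigr => x _.
  by apply: eq_bigl => x'; rewrite esym.
have -> : 4 * D%:R * Nf f = \sum_x D%:R * (2 * abs2 (f x)) + \sum_x D%:R * (2 * abs2 (f x)).
  by rewrite -!mulr_sumr -/(Nf f); ring.
by rewrite lerD//; apply: ler_sum => x _; rewrite S// mulr_ge0 ?abs2_ge0.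
Qed.

Lemma kinetic_le e (D : nat) h B f : 0 < n -> simple_graph e ->
  (max_degree e <= D)%N -> Nf f <= B * n ->
  2 / n * edge_sum e (fun x x' => abs2 (csub (f x) (f x')) / h ^+ 2)
  <= 4 * D%:R * B / h ^+ 2.
Proof.
move=> n0 se degD NB.
have c0 : 0 <= 2 / n by rewrite divr_ge0// ltW.
apply: le_trans (ler_wpM2l c0 (edge_sum_le h f se degD)) _.
have -> : 4 * D%:R * B / h ^+ 2 = 4 * D%:R * (h ^+ 2)^-1 * n^-1 * (B * n).
  by move: (h ^+ 2)^-1 => c; field; rewrite gt_eqF.
have -> : 2 / n * (2 * D%:R * Nf f / h ^+ 2) = 4 * D%:R * (h ^+ 2)^-1 * n^-1 * Nf f.
  by ring.
by rewrite ler_wpM2l// !mulr_ge0 ?ler0n ?invr_ge0 ?sqr_ge0// ltW.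
Qed.

Lemma weight_ge e (D : nat) h beta B f : 0 < n -> 0 <= beta -> simple_graph e ->
  (max_degree e <= D)%N -> Nf f <= B * n ->
  expR (- (4 * beta * D%:R * B / h ^+ 2) + beta / n * \sum_x abs2 (f x) ^+ 2)
  <= weight e h beta B f.
Proof.
move=> n0 b0 se degD NB; rewrite /weight NB mulr1 ler_expR /Hf.
have := ler_wpM2l b0 (kinetic_le h n0 se degD NB).
rewrite mulrBr opprB.
have -> : beta * (4 * D%:R * B / h ^+ 2) = 4 * beta * D%:R * B / h ^+ 2 by ring.
rewrite mulrA; lra.
Qed.

(** * A condensate at one site with a Gaussian bulk of mass about [m] *)

Section witness.
Variables (x0 : V) (r m s : R).
Hypotheses (r0 : 0 <= r) (m0 : 0 < m) (s2 : 2 <= s) (sE : s ^+ 2 = n).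

(** The factor [a] tilts the Gaussian rate: [a = 1] is the profile itself, [1 - s^-1] and [1 + s^-1]
    serve the two exponential Chebyshev bounds. *)
Let site a x : R * R -> R := if x == x0 then box r else gauss (n / m * a).

Let n0 : 0 < n.
Proof. by rewrite -sE exprn_gt0//; move: s2; lra. Qed.

Lemma peak_profile a k : 0 < a -> 0 <= k ->
  [/\ forall f, 0 <= k * \prod_x site a x (f x),
      rmeas (fun f => k * \prod_x site a x (f x)) &
      integral_CV (fun f => (k * \prod_x site a x (f x))%:E) =
      (k * (pi * m / n / a) ^+ #|V|.-1)%:E].
Proof.
move=> a0 k0.
have l0 : 0 < n / m * a by rewrite !mulr_gt0 ?invr_gt0.
have := @integral_CV_scale_prod R V (site a)
  (fun x => if x == x0 then 1 else pi / (n / m * a)) k k0.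
case.
- by move=> x z; rewrite /site; case: eqP => _; [exact: box_ge0|exact: gauss_ge0].
- by move=> x; rewrite /site; case: eqP => _; [exact: measurable_box|exact: measurable_gauss].
- move=> x; rewrite /site; case: eqP => _; first exact: plane_integral_box.
  exact: plane_integral_gauss.
- move=> P0 mP iP; split => //; rewrite iP; congr (_ * _)%:E.
  rewrite (bigD1 x0)//= eqxx mul1r.
  rewrite (eq_bigr (fun=> pi * m / n / a)); last first.
    by move=> x /negbTE ->; field; rewrite !gt_eqF.
  rewrite prodr_const; congr (_ ^+ _).
  by rewrite -(cardC1 x0); apply: eq_card => x; rewrite !inE.
Qed.

Lemma site_prodE a f : \prod_x site a x (f x) =
  box r (f x0) * expR (- (n / m * a * (Nf f - abs2 (f x0)))).
Proof.
rewrite (bigD1 x0)//= /site eqxx; congr (_ * _).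
rewrite (eq_bigr (fun x => expR (- (n / m * a * abs2 (f x))))); last first.
  by move=> x /negbTE ->.
have -> : Nf f = abs2 (f x0) + \sum_(x | x != x0) abs2 (f x) by rewrite /Nf (bigD1 x0).
by rewrite -expR_sum sumrN -mulr_sumr addrAC subrr add0r.
Qed.

Lemma ln_neg_le x : 0 <= x <= 2^-1 -> - (x + x ^+ 2) <= ln (1 - x) :> R.
Proof.
move=> /andP[x0' x1].
have i1 : 1 <= (1 - x)^-1 by rewrite invf_ge1//; lra.
have := ln_le_sinh i1; rewrite lnV ?posrE; last lra.
rewrite invrK.
have -> : ((1 - x)^-1 - (1 - x)) / 2 = x * (1 - x / 2) / (1 - x).
  by field; rewrite gt_eqF//; lra.
have : x * (1 - x / 2) / (1 - x) <= x + x ^+ 2.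
  by rewrite ler_pdivrMr; [nra|lra].
lra.
Qed.

Lemma ln_pos_ge x : 0 <= x -> x - x ^+ 2 <= ln (1 + x) :> R.
Proof.
move=> x0'; have := @ln_ge_pade R (1 + x) ltac:(lra).
apply: le_trans.
have -> : 2 * (1 + x - 1) / (1 + x + 1) = 2 * x / (2 + x).
  by field; rewrite gt_eqF//; lra.
by rewrite ler_pdivlMr; [nra|lra].
Qed.

Lemma expRN2_le : expR (- 2) <= 4^-1 :> R.
Proof.
rewrite expRN lef_pV2 ?posrE ?expR_gt0//.
have -> : 2 = 1 + 1 :> R by [].
rewrite expRD; have := @expR_ge1Dx R 1; nra.
Qed.

(** As [n = s ^+ 2], the power contributes at most [exp (s + 1)], so the offset [4] leaves less than
    [exp (- 2)]. [tail_down] is symmetric. *)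
Lemma tail_up : expR (- (s + 4)) * (1 - s^-1) ^- #|V|.-1 <= 4^-1.
Proof.
have x01 : 0 <= s^-1 <= 2^-1.
  by rewrite invr_ge0 lef_pV2 ?posrE; move: s2; lra.
have sn0 : s != 0 by rewrite gt_eqF//; move: s2; lra.
apply: le_trans expRN2_le.
have V0 : (0 < #|V|)%N by rewrite -(@ltr0n R); exact: n0.
have y0 : 0 < 1 - s^-1 by lra.
rewrite -[1 - s^-1]lnK ?posrE// -expRM_natr -expRN -expRD ler_expR.
have h := ln_neg_le x01.
have k0 : #|V|.-1%:R = n - 1 :> R.
  by rewrite /nV -[in RHS](prednK V0) -natr1 addrK.
have n1 : 1 <= n by rewrite ler1n.
rewrite k0; have := @ler_wpM2r _ (n - 1) ltac:(lra) _ _ h.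
have -> : - (s^-1 + s^-1 ^+ 2) * (n - 1) = - s - 1 + s^-1 + s^-1 ^+ 2.
  by rewrite -sE; field.
have : 0 <= s^-1 ^+ 2 by exact: sqr_ge0.
lra.
Qed.

Lemma tail_down : expR (s - 4) * (1 + s^-1) ^- #|V|.-1 <= 4^-1.
Proof.
have x01 : 0 <= s^-1 <= 2^-1.
  by rewrite invr_ge0 lef_pV2 ?posrE; move: s2; lra.
have sn0 : s != 0 by rewrite gt_eqF//; move: s2; lra.
apply: le_trans expRN2_le.
have V0 : (0 < #|V|)%N by rewrite -(@ltr0n R); exact: n0.
have y0 : 0 < 1 + s^-1 by lra.
rewrite -[1 + s^-1]lnK ?posrE// -expRM_natr -expRN -expRD ler_expR.
have h := ln_pos_ge (proj1 (andP x01)).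
have k0 : #|V|.-1%:R = n - 1 :> R.
  by rewrite /nV -[in RHS](prednK V0) -natr1 addrK.
have n1 : 1 <= n by rewrite ler1n.
rewrite k0; have := @ler_wpM2r _ (n - 1) ltac:(lra) _ _ h.
have -> : (s^-1 - s^-1 ^+ 2) * (n - 1) = s - 1 - s^-1 + s^-1 ^+ 2.
  by rewrite -sE; field.
have : 0 <= s^-1 ^+ 2 by exact: sqr_ge0.
lra.
Qed.

(* Exponential Chebyshev in both directions keeps the mass outside [x0] within
   [m * (1 +- 4 / s)] for the Gaussian profile. *)
Lemma partition_Z_ge_profile e (D : nat) h beta B : 0 <= beta ->
  simple_graph e -> (max_degree e <= D)%N ->
  m * (1 + 4 / s) + r ^+ 2 + 2 * r + 2 <= B * n ->
  ((2^-1 * (expR (- (4 * beta * D%:R * B / h ^+ 2) + beta / n * r ^+ 4 + n - 4 * s)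
     * (pi * m / n) ^+ #|V|.-1))%:E <= partition_Z e h beta B)%E.
Proof.
move=> b0 se degD mB.
have s0 : 0 < s by move: s2; lra.
have x01 : 0 <= s^-1 <= 2^-1.
  by rewrite invr_ge0 lef_pV2 ?posrE; move: s2; lra.
set K := - (4 * beta * D%:R * B / h ^+ 2) + beta / n * r ^+ 4.
(* [k1] keeps the profile below [exp K] once the rescaled mass [a] off [x0] is at least [n - 4 s].
   The extra factors make the tilted profiles dominate the untilted one: that of [k2] for
   [a >= n + 4 s], that of [k3] for [a <= n - 4 s]. *)
pose k1 := expR (K + n - 4 * s).
pose k2 := k1 * expR (- (s + 4)).
pose k3 := k1 * expR (s - 4).
have k10 : 0 <= k1 by exact: expR_ge0.
have k20 : 0 <= k2 by rewrite mulr_ge0 ?expR_ge0.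
have k30 : 0 <= k3 by rewrite mulr_ge0 ?expR_ge0.
have [P10 mP1 iP1] := peak_profile ltr01 k10.
have a2 : 0 < 1 - s^-1 by lra.
have a3 : 0 < 1 + s^-1 by lra.
have [P20 mP2 iP2] := peak_profile a2 k20.
have [P30 mP3 iP3] := peak_profile a3 k30.
set P1 := fun f => k1 * _ in P10 mP1 iP1.
set P2 := fun f => k2 * _ in P20 mP2 iP2.
set P3 := fun f => k3 * _ in P30 mP3 iP3.
have iQ := integral_CVD P20 P30 mP2 mP3; rewrite iP2 iP3 -EFinD in iQ.
have P1le f : P1 f <= weight e h beta B f + (P2 f + P3 f).
  rewrite /P1 /P2 /P3 !site_prodE.
  have w0 : 0 <= weight e h beta B f by exact: weight_ge0.
  have [b0'|bn0] := eqVneq (box r (f x0)) 0.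
    by rewrite b0' !mul0r !mulr0 !addr0.
  have b1 : box r (f x0) = 1.
    by move: bn0; rewrite /box !indicE; do 2 case: (_ \in _); rewrite ?mulr1 ?mul1r ?mul0r ?mulr0 ?eqxx.
  have /andP[X1 X2] := box_abs2 r0 bn0.
  rewrite b1 !mul1r mulr1; set N' := Nf f - abs2 (f x0).
  set a := n / m * N'.
  have aE c : n / m * c * N' = a * c by rewrite /a; ring.
  have e2 : k2 * expR (- (a * (1 - s^-1))) = k1 * expR (- (s + 4) - a * (1 - s^-1)).
    by rewrite /k2 expRD mulrA.
  have e3 : k3 * expR (- (a * (1 + s^-1))) = k1 * expR (s - 4 - a * (1 + s^-1)).
    by rewrite /k3 [in RHS]expRD mulrA.
  rewrite !aE e2 e3.
  have [aup|aup] := lerP (n + 4 * s) a.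
    apply: (@le_trans _ _ (k1 * expR (- (s + 4) - a * (1 - s^-1)))); last first.
      by have := mulr_ge0 k10 (expR_ge0 (s - 4 - a * (1 + s^-1))); lra.
    rewrite ler_wpM2l// ler_expR.
    have : s + 4 <= a * s^-1.
      by rewrite ler_pdivlMr//; move: aup; rewrite -sE; lra.
    lra.
  have [adn|adn] := lerP a (n - 4 * s).
    apply: (@le_trans _ _ (k1 * expR (s - 4 - a * (1 + s^-1)))); last first.
      by have := mulr_ge0 k10 (expR_ge0 (- (s + 4) - a * (1 - s^-1))); lra.
    rewrite ler_wpM2l// ler_expR.
    have : a * s^-1 <= s - 4.
      by rewrite ler_pdivrMr//; move: adn; rewrite -sE; lra.
    lra.
  apply: (@le_trans _ _ (weight e h beta B f)); last first.
    by rewrite lerDl addr_ge0// mulr_ge0 ?expR_ge0.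
  have NB : Nf f <= B * n.
    have : N' <= m * (1 + 4 / s).
      have -> : N' = a * (m / n) by rewrite /a; field; rewrite !gt_eqF.
      have -> : m * (1 + 4 / s) = (n + 4 * s) * (m / n).
        by rewrite -sE; field; rewrite gt_eqF.
      by rewrite ler_wpM2r ?divr_ge0 ?(ltW m0) ?(ltW n0) ?ltW.
    by rewrite /N'; lra.
  apply: le_trans (weight_ge h n0 b0 se degD NB).
  rewrite /k1 -expRD ler_expR /K.
  have : beta / n * r ^+ 4 <= beta / n * \sum_x abs2 (f x) ^+ 2.
    rewrite ler_wpM2l ?divr_ge0 ?(ltW n0)//.
    rewrite (bigD1 x0)//= -[leLHS]addr0 lerD//; last first.
      by apply: sumr_ge0 => x _; exact: sqr_ge0.
    by rewrite -[4%N]/(2 * 2)%N exprM !expr2 ler_pM// ?mulr_ge0.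
  lra.
have Q0 f : 0 <= P2 f + P3 f by exact: addr_ge0 (P20 f) (P30 f).
have mQ := rmeasD mP2 mP3.
apply: le_trans (partition_Z_ge P10 mP1 iP1 Q0 mQ iQ P1le).
rewrite lee_fin divr1.
set p := pi * m / n.
have p0 : 0 <= p ^+ #|V|.-1.
  by rewrite exprn_ge0// /p !mulr_ge0 ?pi_ge0 ?invr_ge0 ?(ltW m0) ?(ltW n0).
rewrite [(p / (1 - _)) ^+ _]expr_div_n [(p / (1 + _)) ^+ _]expr_div_n.
have k1p0 : 0 <= k1 * p ^+ #|V|.-1 by rewrite mulr_ge0.
(* Each tail costs at most a quarter of the main integral; the half that is left is the factor
   [2^-1]. *)
have := ler_wpM2l k1p0 tail_up; have := ler_wpM2l k1p0 tail_down.
rewrite /k2 /k3.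
have -> : k1 * expR (s - 4) * (p ^+ #|V|.-1 / (1 + s^-1) ^+ #|V|.-1) =
  k1 * p ^+ #|V|.-1 * (expR (s - 4) / (1 + s^-1) ^+ #|V|.-1) by ring.
have -> : k1 * expR (- (s + 4)) * (p ^+ #|V|.-1 / (1 - s^-1) ^+ #|V|.-1) =
  k1 * p ^+ #|V|.-1 * (expR (- (s + 4)) / (1 - s^-1) ^+ #|V|.-1) by ring.
rewrite -/k1; lra.
Qed.

End witness.
End lower_bound.

(** The profile has [r ^+ 2 = B y n] and [m = B (1 - y) n (1 - C / s)]. Shrinking the bulk mass by
    [O (sqrt n)] makes room for its fluctuations and for the width of the box, at a cost
    [O (sqrt n)] in the exponent. *)
Lemma partition_Z_lower (R : realType) (beta B y : R) :
  0 <= beta -> 0 < B -> 0 <= y < 1 -> exists2 K : R, 0 < K &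
  forall (V : finType) (e : rel V) (D : nat) (h : R), simple_graph e ->
    (max_degree e <= D)%N -> K <= Num.sqrt (nV R V) ->
    (((pi * B) ^+ #|V| * expR (nV R V + nV R V * gfun (beta * B ^+ 2) y
       - 4 * beta * D%:R * B / h ^+ 2 - K * Num.sqrt (nV R V)))%:E
     <= partition_Z e h beta B)%E.
Proof.
move=> b0 B0 /andP[y0 y1].
have r0 : 0 < 1 - y by lra.
have pi0 : 0 < pi :> R by exact: pi_gt0.
pose w := Num.sqrt (B * y); have w0 : 0 <= w by exact: sqrtr_ge0.
have w2 : w ^+ 2 = B * y by rewrite sqr_sqrtr// mulr_ge0// ltW.
pose p := pi * B * (1 - y); have p0 : 0 < p by rewrite !mulr_gt0.
(* The [4] offsets the Chebyshev window [1 + 4 / s], the fraction offsets the excess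
   [2 w s + 2 <= (2 w + 2) s] of the box. *)
pose C := 4 + (2 * w + 2) / (B * (1 - y)).
have C4 : 4 <= C by rewrite lerDl divr_ge0 ?mulr_ge0 ?(ltW B0) ?(ltW r0)//; lra.
(* Pays for the factor [2^-1] and for the power of [p] missing in the exponent [#|V|.-1]. *)
pose a := `|ln (2 * p)|; have a0 : 0 <= a by exact: normr_ge0.
exists (4 + 2 * C + a); first lra.
move=> V e D h se degD Ks; set n := nV R V in Ks *; set s := Num.sqrt n in Ks *.
have s8 : 2 * C <= s by lra.
have s0 : 0 < s by lra.
have s2 : 2 <= s by lra.
have sE : s ^+ 2 = n by rewrite sqr_sqrtr// ler0n.
have n0 : 0 < n by rewrite -sE exprn_gt0.
have V0 : (0 < #|V|)%N by rewrite -(@ltr0n R).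
have [x0 _] : exists x0 : V, x0 \in V by apply/card_gt0P.
pose x := C / s.
have x01 : 0 <= x <= 2^-1.
  by rewrite divr_ge0 ?(ltW s0)//=; [rewrite ler_pdivrMr//; lra|lra].
have xs : x * s = C by rewrite /x divfK// gt_eqF.
pose m := B * (1 - y) * n * (1 - x).
have m0 : 0 < m by rewrite !mulr_gt0//; lra.
have rr0 : 0 <= w * s by rewrite mulr_ge0// ltW.
have mB : m * (1 + 4 / s) + (w * s) ^+ 2 + 2 * (w * s) + 2 <= B * n.
  have e1 : (w * s) ^+ 2 = B * y * n by rewrite exprMn w2 sE.
  have e2 : B * (1 - y) * (C * s) = 4 * B * (1 - y) * s + (2 * w + 2) * s.
    by rewrite /C; field; rewrite !gt_eqF.
  have e3 : m * (1 + 4 / s) = B * (1 - y) * n + 4 * B * (1 - y) * s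
      - B * (1 - y) * (C * s) - 4 * B * (1 - y) * C.
    by rewrite /m -sE -xs; field; rewrite gt_eqF.
  have : 0 <= 4 * B * (1 - y) * C by rewrite !mulr_ge0//; lra.
  rewrite e1 e3 e2; lra.
have := partition_Z_ge_profile x0 rr0 m0 s2 sE h b0 se degD mB.
apply: le_trans; rewrite lee_fin.
have pm : pi * m / n = p * (1 - x) by rewrite /m /p; field; rewrite gt_eqF.
rewrite pm.
have x1 : 0 < 1 - x by lra.
have px0 : 0 < p * (1 - x) by rewrite mulr_gt0.
have k0 : #|V|.-1%:R = n - 1 :> R.
  by rewrite /n /nV -[in RHS](prednK V0) -natr1 addrK.
have -> : (p * (1 - x)) ^+ #|V|.-1 = expR ((ln p + ln (1 - x)) * (n - 1)).
  by rewrite -k0 expRM_natr -lnM ?posrE// lnK.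
have -> : (pi * B) ^+ #|V| = expR (ln (pi * B) * n).
  by rewrite expRM_natr lnK// posrE mulr_gt0.
have -> : 2^-1 = expR (- ln 2) :> R by rewrite expRN lnK// posrE.
rewrite -!expRD ler_expR /gfun.
have lp : ln p = ln (pi * B) + ln (1 - y) by rewrite /p lnM ?posrE// mulr_gt0.
have l2p : ln (2 * p) = ln 2 + ln p by rewrite lnM ?posrE.
have la : ln 2 + ln p <= a * s.
  rewrite -l2p (le_trans (ler_norm _))// -/a -[leLHS]mulr1 ler_wpM2l//; lra.
have lx : - (2 * C * s) <= ln (1 - x) * (n - 1).
  have h1 : - (2 * x) <= ln (1 - x).
    by apply: le_trans (ln_neg_le x01); move/andP: x01 => [xa xb]; rewrite lerN2; nra.
  have h2 : ln (1 - x) <= 0 by apply: ln_le0; lra.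
  have h3 : - (2 * x) * n <= ln (1 - x) * n by rewrite ler_wpM2r// ltW.
  have h4 : x * n = C * s by rewrite -sE -xs; ring.
  lra.
have e4 : beta / n * (w * s) ^+ 4 = n * (beta * B ^+ 2 * y ^+ 2).
  have -> : (w * s) ^+ 4 = (w ^+ 2 * s ^+ 2) ^+ 2 by ring.
  by rewrite w2 sE; field; rewrite gt_eqF.
by rewrite e4; rewrite lp in la *; lra.
Qed.

(** * Asymptotics *)

Section asymptotics.
Context {R : realType}.
Implicit Types (x a b K : R).

Lemma powR_large K a : 0 < a -> exists2 C, 0 < C & forall x, C < x -> K <= x `^ a.
Proof.
move=> a0; have k0 : 0 < `|K| + 1 by rewrite ltr_wpDl.
exists ((`|K| + 1) `^ a^-1); first exact: powR_gt0.
move=> x xC; apply: (@le_trans _ _ (`|K| + 1)).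
  by rewrite (le_trans (ler_norm _))// lerDl.
have -> : `|K| + 1 = ((`|K| + 1) `^ a^-1) `^ a.
  by rewrite -powRrM mulVf ?gt_eqF// powRr1// ltW.
rewrite ge0_ler_powR ?nnegrE ?powR_ge0 ?(ltW a0) ?ltW//.
by apply: lt_trans xC; rewrite powR_gt0.
Qed.

Lemma powR_dominates K a b : a < b ->
  exists2 C, 0 < C & forall x, C < x -> K * x `^ a <= x `^ b.
Proof.
move=> ab; have ba : 0 < b - a by rewrite subr_gt0.
have [C C0 HC] := powR_large K ba; exists C => // x Cx.
have x0 : 0 < x by exact: lt_trans Cx.
rewrite -[b in leRHS](subrK a) powRD; last by rewrite (gt_eqF x0) implybT.
by rewrite ler_wpM2r ?powR_ge0// HC.
Qed.

Lemma ln_le_2sqrt x : 0 < x -> ln x <= 2 * Num.sqrt x.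
Proof.
move=> x0; have s0 : 0 < Num.sqrt x by rewrite sqrtr_gt0.
rewrite -{1}(sqr_sqrtr (ltW x0)) lnXn// -[leLHS]mulr_natl ler_wpM2l//.
by apply: ltW; exact: ln_sublinear.
Qed.

(** The dominating integral is compared with the lower bound for [Z] at the reference fraction [y].
    The remaining errors are [O (n^al)] with [al < q], and half of the rate [c] absorbs them. *)
Lemma prob_mu_core (beta B p q c y : R) (D : nat) :
  0 <= beta -> 0 < B -> 0 < p -> 2 * p < q -> 4 / 5 < q < 1 -> 0 < c ->
  0 <= y < 1 ->
  exists2 C, 0 < C & forall (V : finType) (e : rel V)
    (E : (V -> R * R) -> Prop) (n := nV R V) (L := n `^ q) (h := n `^ (- p)),
    simple_graph e -> max_degree e = D -> C < n ->
    (forall f y', Nf f <= B * n -> ~ E f -> 0 <= y' <= 1 - n^-1 ->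
      y' <= peak_mass L f / (B * n) <= y' + n^-1 ->
      c * L <= n * (gfun (beta * B ^+ 2) y - gfun (beta * B ^+ 2) y')
               + deviation beta B L f) ->
    1 - expR (- (c / 2 * L)) <= prob_mu e h beta B E.
Proof.
move=> b0 B0 p0 pq /andP[q45 q1] c0 y01.
have [K K0 HK] := partition_Z_lower b0 B0 y01.
(* [2 p] covers the kinetic energy; [7 / 10] covers [ln n * (n / L) <= 2 n^(1/2 + 1 - q)], as
   [q > 4 / 5]. *)
pose al := Num.max (2 * p) (7 / 10).
have alq : al < q by rewrite /al gt_max pq/=; lra.
have al7 : 7 / 10 <= al by rewrite /al le_max lexx orbT.
have alp : 2 * p <= al by rewrite /al le_max lexx.
(* The coefficients of [n^al] in the bounds on [ln n] and in [e1] to [e6] below. *)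
pose T := 2 + 131 * (beta * B ^+ 2) + 6 * B + 32 * B + expR 1 + 4 * beta * D%:R * B + K.
have [Ca Ca0 HCa] := powR_dominates (2 * T / c) alq.
have q0' : 0 < 1 - q by lra.
have [Cb Cb0 HCb] := powR_large (4 * B * beta) q0'.
exists (1 + K ^+ 2 + Ca + Cb); first by rewrite !addr_gt0 ?exprn_gt0.
move=> V e E n L h se degD Cn bad.
have K20 : 0 < K ^+ 2 by rewrite exprn_gt0.
have n1 : 1 <= n by lra.
have n0 : 0 < n by lra.
have L0 : 0 < L by exact: powR_gt0.
have powR_split a b : n `^ (a + b) = n `^ a * n `^ b.
  by rewrite powRD// (gt_eqF n0) implybT.
have nLE : n / L = n `^ (1 - q) by rewrite powR_split powRN powRr1// ltW.
have bL : 4 * B * beta * L <= n.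
  have h1 : 4 * B * beta <= n / L by rewrite nLE; apply: HCb; lra.
  by rewrite -ler_pdivlMr.
have Ks : K <= Num.sqrt n.
  rewrite -[K]ger0_norm ?(ltW K0)// -sqrtr_sqr ler_wsqrtr//; lra.
have [U [u [U0 mU iU ule wU]]] := dominating_function e h n1 B0 b0 L0 bL bad.
have hD : (max_degree e <= D)%N by rewrite degD.
have := HK V e D h se hD Ks.
set z := (pi * B) ^+ #|V| * _ => zZ.
have pB : 0 < (pi * B) ^+ #|V| by rewrite exprn_gt0// mulr_gt0 ?pi_gt0.
have z0 : 0 < z by rewrite mulr_gt0 ?expR_gt0.
(* Under the mass constraint the weight is bounded and a wide Gaussian product loses at most a
   factor [exp 1]. Finiteness matters because [prob_mu] takes [fine] of the integrals. *)
have Zfin : (partition_Z e h beta B < +oo)%E.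
  pose g := (B * n)^-1.
  have g0 : 0 < g by rewrite invr_gt0 mulr_gt0.
  pose k := expR (beta / n * (#|V|%:R * (B * n) ^+ 2) + 1).
  have [P0 mP iP] := @integral_CV_scale_prod R V (fun=> gauss g) (fun=> pi / g) k (expR_ge0 _)
    (fun _ z => gauss_ge0 g z) (fun _ => measurable_gauss g)
    (fun _ => plane_integral_gauss g0).
  apply: (@le_lt_trans _ _ (k * \prod_(x : V) (pi / g))%:E); last exact: ltry.
  rewrite -iP; apply: le_integral_CV => f; first exact: weight_ge0.
  have [NB|NB] := lerP (Nf f) (B * n); last first.
    rewrite /weight ifF ?mulr0; first exact: P0.
    by apply/negbTE; rewrite -ltNge.
  apply: le_trans (weight_le e h b0 NB) _.
  rewrite /gauss -expR_sum -expRD ler_expR.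
  rewrite sumrN -mulr_sumr -/(Nf f).
  have : g * Nf f <= 1 by rewrite mulrC ler_pdivrMr ?mul1r// mulr_gt0.
  have : beta / n * \sum_x abs2 (f x) ^+ 2 <= beta / n * (#|V|%:R * (B * n) ^+ 2).
    rewrite ler_wpM2l ?divr_ge0 ?(ltW n0)// mulr_natl -sumr_const; apply: ler_sum => x _.
    by rewrite !expr2 ler_pM ?abs2_ge0// (le_trans (abs2_le_Nf f x)).
  lra.
apply: le_trans (prob_mu_ge U0 mU iU wU Zfin z0 zZ).
rewrite lerD2l lerN2 ler_pdivrMr//; apply: le_trans ule _.
rewrite /z [leRHS]mulrCA ler_wpM2l ?(ltW pB)// -expRD ler_expR.
set a := n `^ al.
have s7 : Num.sqrt n <= a by rewrite -powR12_sqrt ?(ltW n0)// ler_powR//; lra.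
have one_a : 1 <= a by rewrite -(powRr0 n) ler_powR//; lra.
have lna : ln n <= 2 * a by have := ln_le_2sqrt n0; lra.
have nq1 : n / L <= a by rewrite nLE ler_powR//; lra.
have lnn : ln n * (n / L) <= 2 * a.
  apply: (@le_trans _ _ (2 * Num.sqrt n * (n / L))).
    by rewrite ler_wpM2r ?ln_le_2sqrt// divr_ge0 ?(ltW n0) ?(ltW L0).
  rewrite -mulrA ler_wpM2l// nLE -powR12_sqrt ?(ltW n0)// -powR_split ler_powR//; lra.
have h2 : 1 / h ^+ 2 <= a.
  have -> : h ^+ 2 = n `^ (- (2 * p)).
    by rewrite expr2 -powR_split; congr (_ `^ _); ring.
  by rewrite powRN div1r invrK ler_powR.
have t0 : 0 <= beta * B ^+ 2 by rewrite mulr_ge0// sqr_ge0.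
have Ta : T * a <= c / 2 * L.
  have : 2 * T / c * a <= L by apply: HCa; lra.
  have -> : T * a = c / 2 * (2 * T / c * a) by field; rewrite gt_eqF.
  by move=> ?; rewrite ler_wpM2l// divr_ge0// ltW.
have e1 : 131 * (beta * B ^+ 2) <= 131 * (beta * B ^+ 2) * a by rewrite ler_peMr// mulr_ge0.
have e2 : 3 * ln n * (B * n / L) <= 6 * B * a.
  have -> : 3 * ln n * (B * n / L) = 3 * B * (ln n * (n / L)) by ring.
  by have := ler_wpM2l (_ : 0 <= 3 * B) lnn; rewrite mulr_ge0 ?(ltW B0)// => /(_ isT); lra.
have e3 : 32 * (B * n / L) <= 32 * B * a.
  have -> : 32 * (B * n / L) = 32 * B * (n / L) by ring.
  by rewrite ler_wpM2l ?mulr_ge0 ?(ltW B0).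
have e4 : expR 1 <= expR 1 * a by rewrite ler_peMr ?expR_ge0.
have e5 : 4 * beta * D%:R * B / h ^+ 2 <= 4 * beta * D%:R * B * a.
  have -> : 4 * beta * D%:R * B / h ^+ 2 = 4 * beta * D%:R * B * (1 / h ^+ 2) by ring.
  by rewrite ler_wpM2l ?mulr_ge0 ?(ltW B0)// ler0n.
have e6 : K * Num.sqrt n <= K * a by rewrite ler_wpM2l ?(ltW K0).
rewrite /T in Ta; lra.
Qed.
End asymptotics.

(** * Configurations with a small deviation *)

Section order_statistics.
Context {R : realType} {V : finType}.
Implicit Types (f : V -> R * R) (L : R).

(** Past the end of the list [nth] returns [0], as for the second largest entry on a single vertex;
    hence [0 <= L]. *)
Lemma nth_sort_le (s : seq R) L k : 0 <= L -> {in s, forall a, a <= L} ->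
  nth 0 (sort (fun a b : R => b <= a) s) k <= L.
Proof.
move=> L0 sL; have [ks|ks] := ltnP k (size s).
  by apply: sL; rewrite -(mem_sort (fun a b : R => b <= a)) mem_nth// size_sort.
by rewrite nth_default// size_sort.
Qed.

Lemma Mk_le f L k : 0 <= L -> (forall x, abs2 (f x) <= L) -> Mk k f <= L.
Proof. by move=> L0 fL; apply: nth_sort_le => // a /mapP[x _ ->]. Qed.

Lemma Mk_single_peak f L x0 : 0 <= L -> L < abs2 (f x0) ->
  (forall x, x != x0 -> abs2 (f x) <= L) ->
  Mk 1 f = abs2 (f x0) /\ Mk 2 f <= L.
Proof.
move=> L0 x0L fL.
set r := fun a b : R => b <= a.
pose rest := [seq abs2 (f x) | x <- rem x0 (enum V)].
have restL : {in rest, forall a, a <= L}.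
  move=> a /mapP[x]; rewrite mem_rem_uniq ?enum_uniq// inE => /andP[xx0 _] ->.
  exact: fL.
have rtot : total r by move=> a b; rewrite /r le_total.
have rtr : transitive r by move=> a b c; rewrite /r => ab bc; exact: le_trans bc ab.
have ranti : antisymmetric r by move=> a b; rewrite /r andbC; exact: le_anti.
(* A sorted permutation is unique, so it suffices to exhibit one that starts with the peak. *)
have sE : sort r [seq abs2 (f x) | x <- enum V] = abs2 (f x0) :: sort r rest.
  apply: (sorted_eq rtr ranti); first exact: sort_sorted.
    rewrite /= path_min_sorted ?sort_sorted//.
    apply/allP => a; rewrite mem_sort => /restL aL.
    by rewrite /r (le_trans aL)// ltW.
  apply: perm_trans (permEl (perm_sort _ _)) _.
  have x0V : x0 \in enum V by rewrite mem_enum.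
  apply: perm_trans (perm_map _ (perm_to_rem x0V)) _.
  by rewrite perm_cons perm_sym; exact: permEl (perm_sort _ _).
rewrite /Mk sE/=; split => //.
exact: nth_sort_le.
Qed.
End order_statistics.

(** * From a small deviation to the bounds on energy, mass and maxima *)

Section deterministic.
Context {R : realType} {V : finType}.
Implicit Types (f : V -> R * R) (L B beta y : R) (e : rel V).
Local Notation n := (@nV R V).

Lemma peak_gap f L :
  peak_mass L f ^+ 2 - peak_sq L f =
  \sum_(x in peaks L f) abs2 (f x) * (peak_mass L f - abs2 (f x)).
Proof.
rewrite expr2 {1}/peak_mass mulr_suml /peak_sq -sumrB.
by apply: eq_bigr => x _; rewrite mulrBr expr2.
Qed.

Lemma peak_le_mass f L x : x \in peaks L f -> abs2 (f x) <= peak_mass L f.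
Proof.
move=> xA; rewrite /peak_mass (bigD1 x)//= lerDl sumr_ge0// => y _; exact: abs2_ge0.
Qed.

Lemma peak_gap_ge0 f L : 0 <= peak_mass L f ^+ 2 - peak_sq L f.
Proof.
rewrite peak_gap; apply: sumr_ge0 => x xA.
by rewrite mulr_ge0 ?abs2_ge0// subr_ge0 peak_le_mass.
Qed.

(** Each peak leaves at least one other, of height above [L], so every term of [peak_gap] is at
    least [L] times the height. *)
Lemma peak_gap_ge f L : (1 < #|peaks L f|)%N ->
  peak_mass L f * L <= peak_mass L f ^+ 2 - peak_sq L f.
Proof.
move=> A2; rewrite peak_gap {1}/peak_mass mulr_suml; apply: ler_sum => x xA.
rewrite ler_wpM2l ?abs2_ge0//.
have : (0 < #|peaks L f :\ x|)%N by move: A2; rewrite (cardsD1 x) xA.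
case/card_gt0P => x'; rewrite in_setD1 => /andP[x'x x'A].
rewrite /peak_mass (bigD1 x)//= (bigD1 x')/=; last by rewrite x'A.
have : L < abs2 (f x') by move: x'A; rewrite inE.
have : 0 <= \sum_(i | (i \in peaks L f) && (i != x) && (i != x')) abs2 (f i).
  by apply: sumr_ge0 => i _; exact: abs2_ge0.
lra.
Qed.

Lemma bulk_sq_ge0 f L : 0 <= bulk_sq L f.
Proof. by apply: sumr_ge0 => x _; exact: sqr_ge0. Qed.

Lemma deviation_ge0 beta B L f : 0 < n -> 0 < B -> 0 <= beta -> 0 < L ->
  Nf f <= B * n -> 0 <= deviation beta B L f.
Proof.
move=> n0 B0 b0 L0 NB; rewrite /deviation !addr_ge0//.
- by rewrite mulr_ge0 ?peak_gap_ge0// divr_ge0// ltW.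
- by rewrite divr_ge0 ?(ltW B0)// subr_ge0.
- by rewrite divr_ge0 ?bulk_sq_ge0// !mulr_ge0 ?(ltW B0) ?(ltW L0).
Qed.

Lemma deviation_lt beta B L f c : 0 < n -> 0 < B -> 0 <= beta -> 0 < L ->
  Nf f <= B * n -> deviation beta B L f < c * L ->
  [/\ beta / n * (peak_mass L f ^+ 2 - peak_sq L f) < c * L,
      B * n - Nf f < c * B * L & bulk_sq L f < 4 * B * c * L ^+ 2].
Proof.
move=> n0 B0 b0 L0 NB; rewrite /deviation.
have p1 : 0 <= beta / n * (peak_mass L f ^+ 2 - peak_sq L f).
  by rewrite mulr_ge0 ?peak_gap_ge0// divr_ge0// ltW.
have p2 : 0 <= (B * n - Nf f) / B by rewrite divr_ge0 ?(ltW B0)// subr_ge0.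
have p3 : 0 <= bulk_sq L f / (4 * B * L).
  by rewrite divr_ge0 ?bulk_sq_ge0// !mulr_ge0 ?(ltW B0) ?(ltW L0).
move=> h; split; first lra.
  have -> : c * B * L = c * L * B by ring.
  by rewrite -ltr_pdivrMr//; lra.
have -> : 4 * B * c * L ^+ 2 = c * L * (4 * B * L) by ring.
by rewrite -ltr_pdivrMr ?mulr_gt0//; lra.
Qed.

Lemma Hf_bounds e (D : nat) h B f : 0 < n -> simple_graph e ->
  (max_degree e <= D)%N -> Nf f <= B * n ->
  - (n^-1 * \sum_x abs2 (f x) ^+ 2) <= Hf e h f
  <= 4 * D%:R * B / h ^+ 2 - n^-1 * \sum_x abs2 (f x) ^+ 2.
Proof.
move=> n0 se degD NB; have := kinetic_le h n0 se degD NB.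
rewrite /Hf; set S := n^-1 * _.
have : 0 <= 2 / n * edge_sum e (fun x x' => abs2 (csub (f x) (f x')) / h ^+ 2).
  apply: mulr_ge0; first by rewrite divr_ge0// ltW.
  by apply: edge_sum_ge0 => x x'; rewrite divr_ge0 ?abs2_ge0 ?sqr_ge0.
by move=> a b; apply/andP; split; lra.
Qed.

(** Without peaks all squares are bulk, with sum at most [4 B c L^2 <= L^2]. The kinetic and quartic
    parts of [H / n] are then each at most [(L / n)^2 = n^(- 2 (1 - q))]. *)
Lemma bounds8_of_no_peak e (D : nat) beta B p q c f :
  0 < n -> 0 < B -> 0 <= beta -> 0 < c -> c * B <= 1 -> 4 * B * c <= 1 ->
  simple_graph e -> (max_degree e <= D)%N ->
  4 * D%:R * B * n `^ (2 * p - 1) <= n `^ (2 * q - 2) ->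
  Nf f <= B * n -> peaks (n `^ q) f = finset.set0 ->
  deviation beta B (n `^ q) f < c * n `^ q ->
  bounds8 e (n `^ (- p)) B q f.
Proof.
move=> n0 B0 b0 c0 cB cB4 se degD kin NB A0; set L := n `^ q.
have L0 : 0 < L by exact: powR_gt0.
have powR_split a b : n `^ (a + b) = n `^ a * n `^ b.
  by rewrite powRD// (gt_eqF n0) implybT.
have LnE : n `^ (- (1 - q)) = L / n.
  by rewrite (_ : - (1 - q) = q + - 1); [rewrite powR_split powR_inv1// ltW|ring].
have L2E : n `^ (- (2 * (1 - q))) = (L / n) ^+ 2.
  by rewrite expr2 -LnE -powR_split; congr (_ `^ _); ring.
move=> dev; have [_ d2 d3] := deviation_lt n0 B0 b0 L0 NB dev.
have SE : \sum_x abs2 (f x) ^+ 2 = bulk_sq L f.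
  by rewrite (sum_peaks L f (fun x => abs2 (f x) ^+ 2)) -/(bulk_sq L f) A0 big_set0 add0r.
rewrite /bounds8 LnE L2E; split; last split.
- have /andP[H1 H2] := Hf_bounds (n `^ (- p)) n0 se degD NB.
  rewrite SE in H1 H2.
  have S0 := bulk_sq_ge0 f L.
  have S1 : bulk_sq L f <= L ^+ 2.
    by apply: le_trans (ltW d3) _; rewrite -[leRHS]mul1r ler_wpM2r// sqr_ge0.
  have h2 : 4 * D%:R * B / (n `^ (- p)) ^+ 2 = 4 * D%:R * B * n `^ (2 * p - 1) * n.
    rewrite -[in RHS]mulrA; congr (_ * _).
    rewrite expr2 -powR_split -powRN -[X in _ = _ * X]powRr1 ?(ltW n0)// -powR_split.
    by congr (_ `^ _); ring.
  rewrite h2 in H2.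
  have q2 : n `^ (2 * q - 2) = (L / n) ^+ 2.
    by rewrite -L2E; congr (_ `^ _); ring.
  rewrite q2 in kin.
  have e1 : n^-1 * bulk_sq L f <= (L / n) ^+ 2 * n.
    have -> : (L / n) ^+ 2 * n = n^-1 * L ^+ 2 by field; rewrite gt_eqF.
    by rewrite ler_wpM2l// invr_ge0 ltW.
  have e2 := ler_wpM2r (ltW n0) kin.
  have e3 : 0 <= n^-1 * bulk_sq L f by rewrite mulr_ge0// invr_ge0 ltW.
  have e4 : 0 <= (L / n) ^+ 2 * n by rewrite mulr_ge0 ?sqr_ge0// ltW.
  by rewrite normrM [`|n^-1|]gtr0_norm ?invr_gt0// ler_pdivrMr// ler_norml; apply/andP; split; lra.
- have -> : Nf f / n - B = - ((B * n - Nf f) / n) by field; rewrite gt_eqF.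
  rewrite normrN ger0_norm ?divr_ge0 ?subr_ge0 ?(ltW n0)//.
  rewrite ler_wpM2r ?invr_ge0 ?(ltW n0)// (le_trans (ltW d2))//.
  by rewrite -[leRHS]mul1r ler_wpM2r// ltW.
- rewrite ler_wpM2r ?invr_ge0 ?(ltW n0)//; apply: Mk_le; first exact: ltW.
  move=> x; rewrite leNgt; apply/negP => xL.
  have : x \in peaks L f by rewrite inE.
  by rewrite A0 inE.
Qed.

(* [K0] absorbs all the constants in front of the powers of [n]. *)
Lemma bounds7_of_peak e (D : nat) beta B p q c u y f (K0 : R) :
  1 <= n -> 0 < B -> 0 < beta -> 0 < c -> c * B <= 1 -> 4 * B * c <= 1 ->
  4 * c <= beta * B -> 2 * p < q -> 0 < q < 1 -> 2^-1 <= u <= 1 ->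
  a_fun beta B = B * u ->
  simple_graph e -> (max_degree e <= D)%N ->
  8 <= n `^ ((1 - q) / 2) ->
  4 * D%:R * B + 1 + 4 * B ^+ 2 + 2 * B <= K0 ->
  Nf f <= B * n -> 0 <= y <= 1 - n^-1 ->
  y <= peak_mass (n `^ q) f / (B * n) <= y + n^-1 ->
  (y - u) ^+ 2 <= n `^ (q - 1) ->
  deviation beta B (n `^ q) f < c * n `^ q ->
  bounds7 e (n `^ (- p)) beta B K0 q f.
Proof.
move=> n1 B0 b0 c0 cB cB4 cbB pq /andP[q0 q1] /andP[u1 u2] aE se degD n8 KK NB y01; set L := n `^ q.
have n0 : 0 < n by exact: lt_le_trans n1.
have L0 : 0 < L by exact: powR_gt0.
set Y := peak_mass L f / (B * n) => /andP[yY1 yY2] yu dev.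
have powR_split a b : n `^ (a + b) = n `^ a * n `^ b.
  by rewrite powRD// (gt_eqF n0) implybT.
have LnE : n `^ (- (1 - q)) = L / n.
  by rewrite (_ : - (1 - q) = q + - 1); [rewrite powR_split powR_inv1// ltW|ring].
have [d1 d2 d3] := deviation_lt n0 B0 (ltW b0) L0 NB dev.
set eta := n `^ (- ((1 - q) / 2)).
set eta2 := n `^ (- ((1 - q) / 4)).
have eta0 : 0 < eta by exact: powR_gt0.
have eta20 : 0 < eta2 by exact: powR_gt0.
have eta8 : eta <= 8^-1 by rewrite /eta powRN lef_pV2 ?posrE// powR_gt0.
have eta_le : eta <= eta2 by rewrite ler_powR//; lra.
have Ln_eta : L / n <= eta by rewrite -LnE ler_powR//; lra.
have nieta : n^-1 <= eta.
  by rewrite -powR_inv1 ?(ltW n0)// ler_powR//; lra.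
have yu' : `|y - u| <= eta.
  rewrite -(@ler_pXn2r _ 2)// ?nnegrE ?normr_ge0 ?(ltW eta0)//.
  rewrite real_normK ?num_real// (le_trans yu)//.
  by rewrite expr2 -powR_split ler_powR//; lra.
have Yu : `|Y - u| <= 2 * eta.
  move: yu'; rewrite !ler_norml => /andP[a b]; apply/andP; split; lra.
have /andP[Yu1 Yu2] : - (2 * eta) <= Y - u <= 2 * eta by rewrite -ler_norml.
(* From [u >= 2^-1] and [2 eta <= 4^-1]: the peak mass is macroscopic. *)
have Y4 : 4^-1 <= Y by lra.
have SE : peak_mass L f = B * n * Y by rewrite /Y; field; rewrite !gt_eqF.
have S0 : 0 < peak_mass L f by rewrite SE; apply: mulr_gt0; [exact: mulr_gt0|lra].
(* A second peak would cost at least [beta B Y L >= c L] by [peak_gap_ge], and an empty peak set has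
   mass [0]. *)
have A1 : #|peaks L f| = 1%N.
  apply/eqP; rewrite eqn_leq; apply/andP; split.
    rewrite leqNgt; apply/negP => /peak_gap_ge gap.
    move: d1; apply/negP; rewrite -leNgt.
    have bn0 : 0 <= beta / n by rewrite divr_ge0// ltW.
    apply: le_trans (ler_wpM2l bn0 gap); rewrite SE.
    have -> : beta / n * (B * n * Y * L) = beta * B * Y * L by field; rewrite gt_eqF.
    rewrite ler_wpM2r ?(ltW L0)//.
    have : beta * B * 4^-1 <= beta * B * Y by rewrite ler_wpM2l// mulr_ge0 ?ltW.
    lra.
  rewrite lt0n cards_eq0; apply/eqP => A0.
  by move: S0; rewrite /peak_mass A0 big_set0 ltxx.
have /eqP/cards1P[x0 Ax0] := A1.
have X0E : abs2 (f x0) = B * n * Y by rewrite -SE /peak_mass Ax0 big_set1.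
have [M1 M2] : Mk 1 f = abs2 (f x0) /\ Mk 2 f <= L.
  apply: Mk_single_peak; first exact: ltW.
    have : x0 \in peaks L f by rewrite Ax0 set11.
    by rewrite inE.
  move=> x xx0; rewrite leNgt; apply/negP => xL.
  have : x \in peaks L f by rewrite inE.
  by rewrite Ax0 inE (negbTE xx0).
have KD : 0 <= 4 * D%:R * B by rewrite !mulr_ge0 ?(ltW B0)// ler0n.
have B20 : 0 < B ^+ 2 by rewrite exprn_gt0.
have K1 : 1 <= K0 by lra.
rewrite /bounds7 aE -/eta -/eta2 LnE; split; last split; last split.
(* [H / n + a^2] splits into the kinetic part, the bulk squares and [B^2 (u^2 - Y^2)], each of order
   [eta2]. *)
- have /andP[H1 H2] := Hf_bounds (n `^ (- p)) n0 se degD NB.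
  have SSE : \sum_x abs2 (f x) ^+ 2 = (B * n * Y) ^+ 2 + bulk_sq L f.
    by rewrite (sum_peaks L f (fun x => abs2 (f x) ^+ 2)) -/(bulk_sq L f) Ax0 big_set1 X0E.
  rewrite SSE in H1 H2.
  move: H1 H2; move: (Hf e _ f) => H H1 H2.
  have b0' := bulk_sq_ge0 f L.
  have S1 : bulk_sq L f <= L ^+ 2.
    by apply: le_trans (ltW d3) _; rewrite -[leRHS]mul1r ler_wpM2r// sqr_ge0.
  set T := n^-1 * _ in H1 H2.
  have TE : T / n = B ^+ 2 * Y ^+ 2 + bulk_sq L f / n ^+ 2.
    by rewrite /T; field; rewrite gt_eqF.
  have h2 : 4 * D%:R * B / (n `^ (- p)) ^+ 2 / n = 4 * D%:R * B * n `^ (2 * p - 1).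
    rewrite -mulrA; congr (_ * _).
    rewrite expr2 -powR_split -powRN -[n^-1]powR_inv1 ?(ltW n0)// -powR_split.
    by congr (_ `^ _); ring.
  have ni : 0 <= n^-1 by rewrite invr_ge0 ltW.
  have H1' := ler_wpM2r ni H1; have H2' := ler_wpM2r ni H2.
  rewrite mulrBl h2 TE in H2'; rewrite mulNr TE in H1'.
  have kin : n `^ (2 * p - 1) <= eta2 by rewrite ler_powR//; lra.
  have kin' := ler_wpM2l KD kin.
  have S2 : 0 <= bulk_sq L f / n ^+ 2 <= eta2.
    rewrite divr_ge0 ?sqr_ge0//=; apply: (@le_trans _ _ ((L / n) ^+ 2)).
      by rewrite expr_div_n ler_wpM2r// invr_ge0 sqr_ge0.
    rewrite -LnE expr2 -powR_split ler_powR//; lra.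
  have /andP[S2a S2b] := S2.
  have YY : `|B ^+ 2 * (u ^+ 2 - Y ^+ 2)| <= 4 * B ^+ 2 * eta2.
    rewrite normrM (gtr0_norm B20).
    have -> : 4 * B ^+ 2 * eta2 = B ^+ 2 * (4 * eta2) by ring.
    rewrite ler_wpM2l ?(ltW B20)//.
    have -> : u ^+ 2 - Y ^+ 2 = (u - Y) * (u + Y) by ring.
    have Y1 : Y <= 1.
      rewrite /Y ler_pdivrMr ?mulr_gt0// mul1r (le_trans _ NB)//.
      by rewrite /Nf (sum_peaks L f (fun x => abs2 (f x))) lerDl sumr_ge0// => x _; exact: abs2_ge0.
    have uY0 : 0 < u + Y by lra.
    have uY2 : u + Y <= 2 by lra.
    rewrite normrM distrC (gtr0_norm uY0).
    apply: (@le_trans _ _ (2 * eta * 2)); last lra.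
    by apply: ler_pM => //; exact: ltW.
  move: YY; rewrite !ler_norml => /andP[YY1 YY2].
  have KE : (4 * D%:R * B + 1 + 4 * B ^+ 2 + 2 * B) * eta2 <= K0 * eta2.
    by rewrite ler_wpM2r// ltW.
  have Be : 0 <= B * eta2 by rewrite mulr_ge0 ?(ltW B0) ?(ltW eta20).
  have De : 0 <= 4 * D%:R * B * eta2 by rewrite mulr_ge0 ?(ltW eta20).
  by apply/andP; split; rewrite exprMn; lra.
- have -> : Nf f / n - B = - ((B * n - Nf f) / n) by field; rewrite gt_eqF.
  rewrite normrN ger0_norm ?divr_ge0 ?subr_ge0 ?(ltW n0)//.
  apply: (@le_trans _ _ (L / n)).
    rewrite ler_wpM2r ?invr_ge0 ?(ltW n0)// (le_trans (ltW d2))//.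
    by rewrite -[leRHS]mul1r ler_wpM2r// ltW.
  by apply: le_trans Ln_eta _; rewrite ler_peMl// ltW.
- rewrite M1 X0E; have -> : B * n * Y / n - B * u = B * (Y - u) by field; rewrite gt_eqF.
  rewrite normrM (gtr0_norm B0).
  apply: (@le_trans _ _ (B * (2 * eta2))).
    by rewrite ler_wpM2l ?(ltW B0)//; lra.
  have -> : B * (2 * eta2) = 2 * B * eta2 by ring.
  by rewrite ler_wpM2r ?(ltW eta20)//; lra.
- apply: (@le_trans _ _ (L / n)); first by rewrite ler_wpM2r ?invr_ge0 ?(ltW n0).
  by rewrite ler_peMl// divr_ge0 ?(ltW L0) ?(ltW n0).
Qed.
End deterministic.

(** * The three phases *)

Section phases.
Context {R : realType}.
Implicit Types (beta B p q c C K L : R).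

Lemma gfun0 (t : R) : gfun t 0 = 0.
Proof. by rewrite /gfun expr2 !mulr0 subr0 ln1 addr0. Qed.

Lemma a_fun_cond_frac beta B : a_fun beta B = B * cond_frac (beta * B ^+ 2).
Proof. by rewrite /a_fun /cond_frac; field. Qed.

Lemma tail_bound_weaken c C L (P : R) : 0 < c -> 2 / c <= C -> 0 <= L ->
  1 - expR (- (c / 2 * L)) <= P -> 1 - expR (- (L / C)) <= P.
Proof.
move=> c0 cC L0; apply: le_trans; rewrite lerD2l lerN2 ler_expR lerN2.
have C0 : 0 < C by apply: lt_le_trans cC; rewrite divr_gt0.
rewrite mulrC ler_wpM2r// -[leLHS]mul1r ler_pdivrMr//.
by move: cC; rewrite ler_pdivrMr//; lra.
Qed.

(** One peak alone carries the fraction [L / (B n)]; rounding loses [n^-1], at most half of it once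
    [2 B <= L]. *)
Lemma grid_fraction_ge (V : finType) (f : V -> R * R) B L y (n := nV R V) :
  0 < n -> 0 < B -> 2 * B <= L -> peaks L f != finset.set0 ->
  peak_mass L f / (B * n) <= y + n^-1 -> L / (2 * B) <= n * y.
Proof.
move=> n0 B0 BL /set0Pn[x xA] yY.
have h1 : L <= peak_mass L f.
  by apply: le_trans (peak_le_mass xA); move: xA; rewrite inE => /ltW.
have h2 : L / (B * n) <= y + n^-1.
  by apply: le_trans yY; rewrite ler_wpM2r// invr_ge0 mulr_ge0// ltW.
have := ler_wpM2l (ltW n0) h2.
have -> : n * (L / (B * n)) = 2 * (L / (2 * B)) by field; rewrite !gt_eqF.
rewrite mulrDr divff ?gt_eqF//.
have : 1 <= L / (2 * B) by rewrite ler_pdivlMr ?mulr_gt0// mul1r.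
lra.
Qed.

Section fixed_parameters.
Variables (beta B p : R) (D : nat).
Hypotheses (beta0 : 0 <= beta) (B0 : 0 < B) (p0 : 0 < p) (p1 : p < 2^-1).
Let t := beta * B ^+ 2.

Let K0 := 4 * D%:R * B + 1 + 4 * B ^+ 2 + 2 * B.
Let K00 : 0 < K0.
Proof.
rewrite /K0; have : 0 <= 4 * D%:R * B by rewrite !mulr_ge0 ?ler0n ?(ltW B0).
have := B0; have : 0 < B ^+ 2 by rewrite exprn_gt0.
by lra.
Qed.

Lemma min_rate c1 a : 0 < c1 -> 0 < a -> exists c, [/\ 0 < c, c <= c1, c <= a,
  c * B <= 1 & 4 * B * c <= 1].
Proof.
move=> c10 a0; have B40 : 0 < 4 * B by rewrite mulr_gt0.
exists (Num.min (Num.min c1 a) (4 * B)^-1).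
set c := Num.min _ _.
have h : 4 * B * c <= 1.
  by rewrite mulrC -ler_pdivlMr// mul1r ge_min lexx orbT.
have c0 : 0 < c by rewrite !lt_min c10 a0 invr_gt0.
have cB : 0 < c * B by rewrite mulr_gt0.
split => //; first by rewrite !ge_min lexx.
- by rewrite !ge_min lexx orbT.
- by lra.
Qed.

(** The reference fraction is [u], with level [m_fun t]. If the total cost is below [c L], so are
    both its nonnegative parts: [y] is within [n^((q - 1) / 2)] of [u] and the deviation is small,
    so [bounds7_of_peak] applies. *)
Lemma supercritical q : theta_c R < t -> Num.max (2 * p) (4 / 5) < q < 1 ->
  exists C : R, 0 < C /\
    forall (V : finType) (e : rel V), simple_graph e -> max_degree e = D ->
      C < nV R V -> let h := powR (nV R V) (- p) in
      1 - expR (- (powR (nV R V) q / C))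
      <= prob_mu e h beta B (bounds7 e h beta B C q).
Proof.
rewrite gt_max => tct /andP[/andP[pq q45] q1].
have [tc2 _] := @theta_cP R.
have t2 : 2 <= t by apply: le_trans (ltW tct).
have b0 : 0 < beta.
  rewrite lt_neqAle beta0 andbT; apply/eqP => b0.
  by move: t2; rewrite /t -b0 mul0r; lra.
have [m0 [c1 c10 gc]] := gfun_super tct.
have /andP[u1 u2] := cond_frac_itv t2; set u := cond_frac t in u1 u2 gc.
have bB0 : 0 < beta * B / 4 by rewrite divr_gt0 ?mulr_gt0.
have [c [c0 cc1 cbB cB cB4]] := min_rate c10 bB0.
have u01 : 0 <= u < 1 by rewrite u2 andbT; lra.
have q45' : 4 / 5 < q < 1 by rewrite q45.
have q01 : 0 < q < 1 by rewrite q1 andbT; lra.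
have uu : 2^-1 <= u <= 1 by rewrite u1 ltW.
have cbB4 : 4 * c <= beta * B by lra.
have [Ca Ca0 HCa] := prob_mu_core D beta0 B0 p0 pq q45' c0 u01.
have q2 : 0 < (1 - q) / 2 by lra.
have [Cb Cb0 HCb] := powR_large 8 q2.
have c20 : 0 < 2 / c by rewrite divr_gt0.
pose C := 1 + Ca + Cb + K0 + 2 / c.
have K00' := K00.
exists C; split; first by rewrite /C; lra.
move=> V e se degD Cn; cbv zeta; rewrite /C in Cn.
set n := nV R V in Cn *.
have n1 : 1 <= n by lra.
have n0 : 0 < n by lra.
apply: (tail_bound_weaken c0); rewrite ?powR_ge0//; first by rewrite /C; lra.
apply: HCa => //; first by rewrite -/n; lra.
rewrite -/n => f y NB nE y01 yY; rewrite leNgt; apply/negP => bad.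
have y1 : 0 <= y < 1.
  have : 0 < n^-1 by rewrite invr_gt0.
  by move: y01; lra.
have L0 : 0 < n `^ q by exact: powR_gt0.
have dev0 : 0 <= deviation beta B (n `^ q) f by exact: deviation_ge0.
have gu : gfun (beta * B ^+ 2) u = m_fun t by rewrite (m_fun_gfun t2).
rewrite gu in bad.
have g1 : n * (c1 * (y - u) ^+ 2) <= n * (m_fun t - gfun (beta * B ^+ 2) y).
  by rewrite ler_wpM2l ?(ltW n0)//; have := gc y y1; rewrite -/t; lra.
have g2 : 0 <= n * (c1 * (y - u) ^+ 2).
  by rewrite mulr_ge0 ?(ltW n0)// mulr_ge0 ?(ltW c10)// sqr_ge0.
have LnE : n `^ (q - 1) = n `^ q / n.
  by rewrite powRB ?powRr1 ?(ltW n0)// (gt_eqF n0) implybT.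
have dev : deviation beta B (n `^ q) f < c * n `^ q by lra.
apply: nE; apply: (@bounds7_of_peak R V e D beta B p q c u y f C) => //.
- exact: a_fun_cond_frac.
- by rewrite degD.
- by apply: HCb; lra.
- by rewrite /C -/K0; lra.
- rewrite LnE ler_pdivlMr//.
  have h1 : c * n `^ q <= c1 * n `^ q by rewrite ler_wpM2r ?(ltW L0).
  rewrite -(ler_pM2l c10); lra.
Qed.

(** The threshold [(1 + 2 p) / 2 < q] says that the kinetic part of [H / n], of order [n^(2 p - 1)],
    is below the accuracy [n^(2 q - 2)] of [bounds8]. *)
Lemma max_thresholds q : Num.max ((1 + 2 * p) / 2) (17 / 18) < q < 1 ->
  [/\ 2 * p < q, 4 / 5 < q < 1, 2 * p - 1 < 2 * q - 2 & 0 < q].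
Proof.
rewrite gt_max => /andP[/andP[h1 h2] h3]; have := p0; have := p1.
by move=> hp1 hp0; split; try lra; apply/andP; split; lra.
Qed.

(** The reference fraction is [0], where the rate vanishes. Any peak forces [n y >= L / (2 B)], and
    [c <= c1 / (2 B)] makes its cost reach [c L]; so a cheap configuration has no peak. *)
Lemma subcritical q : t < theta_c R ->
  Num.max ((1 + 2 * p) / 2) (17 / 18) < q < 1 ->
  exists C : R, 0 < C /\
    forall (V : finType) (e : rel V), simple_graph e -> max_degree e = D ->
      C < nV R V -> let h := powR (nV R V) (- p) in
      1 - expR (- (powR (nV R V) q / C))
      <= prob_mu e h beta B (bounds8 e h B q).
Proof.
move=> ttc /max_thresholds[pq q45 pq2 q0].
have t0 : 0 <= t by rewrite mulr_ge0 ?sqr_ge0.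
have t01 : 0 <= t < theta_c R by rewrite t0.
have [c1 c10 gc] := gfun_sub t01.
have c1B0 : 0 < c1 / (2 * B) by rewrite divr_gt0 ?mulr_gt0.
have [c [c0 _ ccB cB cB4]] := min_rate c10 c1B0.
have y00 : 0 <= (0 : R) < 1 by rewrite lexx ltr01.
have [Ca Ca0 HCa] := prob_mu_core D beta0 B0 p0 pq q45 c0 y00.
have [Cb Cb0 HCb] := powR_large (2 * B) q0.
have [Cc Cc0 HCc] := powR_dominates (4 * D%:R * B) pq2.
have c20 : 0 < 2 / c by rewrite divr_gt0.
pose C := 1 + Ca + Cb + Cc + 2 / c.
exists C; split; first by rewrite /C; lra.
move=> V e se degD Cn; cbv zeta; rewrite /C in Cn.
set n := nV R V in Cn *.
have n0 : 0 < n by lra.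
apply: (tail_bound_weaken c0); rewrite ?powR_ge0//; first by rewrite /C; lra.
apply: HCa => //; first by rewrite -/n; lra.
rewrite -/n gfun0 => f y NB nE y01 yY; rewrite leNgt; apply/negP => bad.
have y1 : 0 <= y < 1.
  have : 0 < n^-1 by rewrite invr_gt0.
  by move: y01; lra.
have L0 : 0 < n `^ q by exact: powR_gt0.
have dev0 : 0 <= deviation beta B (n `^ q) f by exact: deviation_ge0.
have g1 : n * (c1 * y) <= n * (0 - gfun (beta * B ^+ 2) y).
  by rewrite ler_wpM2l ?(ltW n0)//; have := gc y y1; rewrite -/t; lra.
have g2 : 0 <= n * (c1 * y).
  by rewrite !mulr_ge0 ?(ltW n0) ?(ltW c10)//; case/andP: y1.
have [A0|A0] := eqVneq (peaks (n `^ q) f) finset.set0.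
  have dev : deviation beta B (n `^ q) f < c * n `^ q by lra.
  apply: nE; apply: (@bounds8_of_no_peak R V e D beta B p q c f) => //.
    by rewrite degD.
  by apply: HCc; lra.
have BL : 2 * B <= n `^ q by apply: HCb; lra.
have /andP[_ yY2] := yY.
have := grid_fraction_ge n0 B0 BL A0 yY2.
rewrite -/n => /(ler_wpM2l (ltW c10)) h1.
have : c * n `^ q <= c1 / (2 * B) * n `^ q by rewrite ler_wpM2r ?(ltW L0).
have -> : c1 / (2 * B) * n `^ q = c1 * (n `^ q / (2 * B)) by ring.
lra.
Qed.

(** Both maximisers [0] and [u] have rate [0]. Without peaks [bounds8] follows as in the subcritical
    phase; with a peak, [y] must be close to [u] and [bounds7] follows as in the supercritical
    one. *)
Lemma critical q : t = theta_c R ->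
  Num.max ((1 + 2 * p) / 2) (17 / 18) < q < 1 ->
  exists C : R, 0 < C /\
    forall (V : finType) (e : rel V), simple_graph e -> max_degree e = D ->
      C < nV R V -> let h := powR (nV R V) (- p) in
      1 - expR (- (powR (nV R V) q / C))
      <= prob_mu e h beta B
           (fun f => bounds7 e h beta B C q f \/ bounds8 e h B q f).
Proof.
move=> ttc /max_thresholds[pq q45 pq2 q0]; have /andP[_ q1] := q45.
have [] := @theta_cP R; rewrite -ttc => t2 mt.
have b0 : 0 < beta.
  rewrite lt_neqAle beta0 andbT; apply/eqP => b0.
  by move: t2; rewrite /t -b0 mul0r; lra.
have [c1 c10 gc] := gfun_crit t2 mt.
have /andP[u1 u2] := cond_frac_itv t2; set u := cond_frac t in u1 u2 gc.
have bB0 : 0 < beta * B / 4 by rewrite divr_gt0 ?mulr_gt0.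
have c1B0 : 0 < c1 / (2 * B) by rewrite divr_gt0 ?mulr_gt0.
have mn0 : 0 < Num.min (beta * B / 4) (c1 / (2 * B)) by rewrite lt_min bB0.
have [c [c0 cc1 + cB cB4]] := min_rate c10 mn0.
rewrite le_min => /andP[cbB ccB].
have q01 : 0 < q < 1 by rewrite q0.
have uu : 2^-1 <= u <= 1 by rewrite u1 ltW.
have cbB4 : 4 * c <= beta * B by lra.
have y00 : 0 <= (0 : R) < 1 by rewrite lexx ltr01.
have [Ca Ca0 HCa] := prob_mu_core D beta0 B0 p0 pq q45 c0 y00.
have [Cb Cb0 HCb] := powR_large (2 * B) q0.
have [Cc Cc0 HCc] := powR_dominates (4 * D%:R * B) pq2.
have q2 : 0 < (1 - q) / 2 by lra.
have [Cd Cd0 HCd] := powR_large 8 q2.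
have c20 : 0 < 2 / c by rewrite divr_gt0.
have K00' := K00.
pose C := 1 + Ca + Cb + Cc + Cd + K0 + 2 / c.
exists C; split; first by rewrite /C; lra.
move=> V e se degD Cn; cbv zeta; rewrite /C in Cn.
set n := nV R V in Cn *.
have n1 : 1 <= n by lra.
have n0 : 0 < n by lra.
apply: (tail_bound_weaken c0); rewrite ?powR_ge0//; first by rewrite /C; lra.
apply: HCa => //; first by rewrite -/n; lra.
rewrite -/n gfun0 => f y NB nE y01 yY; rewrite leNgt; apply/negP => bad.
have y1 : 0 <= y < 1.
  have : 0 < n^-1 by rewrite invr_gt0.
  by move: y01; lra.
have L0 : 0 < n `^ q by exact: powR_gt0.
have dev0 : 0 <= deviation beta B (n `^ q) f by exact: deviation_ge0.
set mn := fun y => Num.min y ((y - u) ^+ 2) in gc.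
have g1 : n * (c1 * mn y) <= n * (0 - gfun (beta * B ^+ 2) y).
  by rewrite ler_wpM2l ?(ltW n0)//; have := gc y y1; rewrite -/t -/(mn y); lra.
have g2 : 0 <= n * (c1 * mn y).
  rewrite mulr_ge0 ?(ltW n0)// mulr_ge0 ?(ltW c10)// /mn le_min sqr_ge0 andbT.
  by case/andP: y1.
have [A0|A0] := eqVneq (peaks (n `^ q) f) finset.set0.
  have dev : deviation beta B (n `^ q) f < c * n `^ q by lra.
  apply: nE; right; apply: (@bounds8_of_no_peak R V e D beta B p q c f) => //.
    by rewrite degD.
  by apply: HCc; lra.
have BL : 2 * B <= n `^ q by apply: HCb; lra.
have /andP[_ yY2] := yY.
have := grid_fraction_ge n0 B0 BL A0 yY2.
rewrite -/n => /(ler_wpM2l (ltW c10)) h1.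
have h2 : c * n `^ q <= c1 / (2 * B) * n `^ q by rewrite ler_wpM2r ?(ltW L0).
have h3 : c1 / (2 * B) * n `^ q = c1 * (n `^ q / (2 * B)) by ring.
have LnE : n `^ (q - 1) = n `^ q / n.
  by rewrite powRB ?powRr1 ?(ltW n0)// (gt_eqF n0) implybT.
(* With a peak present the linear branch of the minimum would already cost [c1 n y >= c L]. *)
have mnE : mn y = (y - u) ^+ 2.
  rewrite /mn; case: leP => // yu; exfalso; move: g1; rewrite /mn min_l//.
  lra.
rewrite mnE in g1 g2.
have dev : deviation beta B (n `^ q) f < c * n `^ q by lra.
apply: nE; left; apply: (@bounds7_of_peak R V e D beta B p q c u y f C) => //.
- exact: a_fun_cond_frac.
- by rewrite degD.
- by apply: HCd; lra.
- by rewrite /C -/K0; lra.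
- rewrite LnE ler_pdivlMr//.
  have h4 : c * n `^ q <= c1 * n `^ q by rewrite ler_wpM2r ?(ltW L0).
  rewrite -(ler_pM2l c10); lra.
Qed.

End fixed_parameters.
End phases.

Theorem theorem2p2 (R : realType) (beta B : R) (D : nat) (p : R) :
  0 <= beta -> 0 < B -> (1 <= D)%N -> 0 < p < 2^-1 ->
  (* (i) *)
  (forall q : R, theta_c R < beta * B ^+ 2 ->
     Num.max (2 * p) (4 / 5) < q < 1 ->
     exists C : R, 0 < C /\
       forall (V : finType) (e : rel V),
         simple_graph e -> max_degree e = D ->
         C < @nV R V ->
         let h := powR (@nV R V) (- p) in
         1 - expR (- (powR (@nV R V) q / C))
           <= prob_mu e h beta B (bounds7 e h beta B C q)) /\
  (* (ii) *)
  (forall q : R, beta * B ^+ 2 < theta_c R ->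
     Num.max ((1 + 2 * p) / 2) (17 / 18) < q < 1 ->
     exists C : R, 0 < C /\
       forall (V : finType) (e : rel V),
         simple_graph e -> max_degree e = D ->
         C < @nV R V ->
         let h := powR (@nV R V) (- p) in
         1 - expR (- (powR (@nV R V) q / C))
           <= prob_mu e h beta B (bounds8 e h B q)) /\
  (* (iii) *)
  (forall q : R, beta * B ^+ 2 = theta_c R ->
     Num.max ((1 + 2 * p) / 2) (17 / 18) < q < 1 ->
     exists C : R, 0 < C /\
       forall (V : finType) (e : rel V),
         simple_graph e -> max_degree e = D ->
         C < @nV R V ->
         let h := powR (@nV R V) (- p) in
         1 - expR (- (powR (@nV R V) q / C))
           <= prob_mu e h beta B
                (fun f => bounds7 e h beta B C q f \/ bounds8 e h B q f)).
Proof.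
move=> beta0 B0 _ /andP[p0 p1]; split; last split => q.
- by move=> q; exact: supercritical.
- exact: subcritical.
- exact: critical.
Qed.
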